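(* Let $n$ be an even positive integer, let $N$ be a Poincaré duality complex of dimension $2n$, and let $\tau:S^{n-1}\to F(2n)$ be a map. Then there is a homotopy equivalence $$\mathcal{G}_\tau(N)-\ast\;\simeq\; N_0\rtimes S^{n-1}.$$
   Context: $F(2n)$ denotes the space (an $H$-space) of self homotopy equivalences of $S^{2n-1}$. Write $N=N_0\cup_g D^{2n}$ with $g:S^{2n-1}\to N_0$ the attaching map of the top cell. $\mathcal{G}_\tau(N)$ is the pushout of $$N_0\times S^{n-1}\xleftarrow{(\phi,\pi_2)}S^{2n-1}\times S^{n-1}\xrightarrow{\,i\,}S^{2n-1}\times D^n,$$ where $i$ is the inclusion, $\pi_1,\pi_2$ are the projections, and $\phi$ is the composite $$S^{2n-1}\times S^{n-1}\xrightarrow{t}S^{2n-1}\times S^{n-1}\xrightarrow{\pi_1}S^{2n-1}\xrightarrow{g}N_0,\qquad t(x,s)=(\tau(s)x,s).$$ $\mathcal{G}_\tau(N)-\ast$ is the complement of a point in the interior of the top-dimensional $(3n-1)$-cell (equivalently, the complement of the interior of a $(3n-1)$-disc in $S^{2n-1}\times D^n$). $X\rtimes Y=(X\times Y)/(\ast\times Y)$. *)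

(* Defs.v *)
From HB Require Import structures.
From mathcomp Require Import all_boot all_order all_algebra.
From mathcomp Require Import all_classical all_reals all_analysis.
From mathcomp Require Import freeg.
From Stdlib Require Import Relation_Operators.

Set Implicit Arguments.
Unset Strict Implicit.
Unset Printing Implicit Defensive.

Import Order.TTheory GRing.Theory Num.Theory.
Import numFieldNormedType.Exports.

Local Open Scope classical_set_scope.
Local Open Scope ring_scope.
Local Open Scope quotient_scope.

Section SumTopology.
Variables X Y : topologicalType.

Definition sum_open (U : set (X + Y)) : Prop :=
  open ((inl : X -> X + Y) @^-1` U) /\ open ((inr : Y -> X + Y) @^-1` U).

Let sum_openT : sum_open setT.
Proof. by split; rewrite preimage_setT; exact: openT. Qed.

Let sum_openI : setI_closed sum_open.
Proof. by move=> U V [? ?] [? ?]; split; rewrite preimage_setI; exact: openI. Qed.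

Let sum_open_bigU (I : Type) (F : I -> set (X + Y)) :
  (forall i, sum_open (F i)) -> sum_open (\bigcup_i F i).
Proof.
by move=> oF; split; rewrite preimage_bigcup; apply: bigcup_open => i _;
  have [] := oF i.
Qed.

HB.instance Definition _ :=
  isOpenTopological.Build (X + Y)%type sum_openT sum_openI sum_open_bigU.

End SumTopology.

Section Quotient.
Variables (T : topologicalType) (r : T -> T -> Prop).

Definition gen_equiv : rel T := fun x y => `[< clos_refl_sym_trans T r x y >].

Let gen_equiv_refl : reflexive gen_equiv.
Proof. by move=> x; apply/asboolP; exact: rst_refl. Qed.

Let gen_equiv_sym : symmetric gen_equiv.
Proof. by move=> x y; apply/asboolP/asboolP; exact: rst_sym. Qed.

Let gen_equiv_trans : transitive gen_equiv.
Proof. by move=> y x z /asboolP xy /asboolP yz; apply/asboolP/(rst_trans _ _ _ y). Qed.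

Definition gen_equiv_rel : equiv_rel T :=
  EquivRel gen_equiv gen_equiv_refl gen_equiv_sym gen_equiv_trans.

Definition quot_space : topologicalType :=
  quotient_topology {eq_quot gen_equiv_rel}.

Definition quot_proj (x : T) : quot_space := \pi_({eq_quot gen_equiv_rel}) x.

End Quotient.

Section Pushout.
Variables (A X Y : topologicalType) (f : A -> X) (g : A -> Y).

Definition pushout_rel (u v : X + Y) : Prop :=
  exists a : A, u = inl (f a) /\ v = inr (g a).

Definition pushout : topologicalType := quot_space pushout_rel.
Definition pushout_inl (x : X) : pushout := quot_proj pushout_rel (inl x).
Definition pushout_inr (y : Y) : pushout := quot_proj pushout_rel (inr y).

End Pushout.

Section HalfSmash.
Variables (X : topologicalType) (x0 : X) (Y : topologicalType).

Definition half_smash_rel (p q : X * Y) : Prop := p.1 = x0 /\ q.1 = x0.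

(* [X ><| Y = (X * Y) / ({x0} * Y)] *)
Definition half_smash : topologicalType := quot_space half_smash_rel.

End HalfSmash.

Definition homeomorphic (X Y : topologicalType) : Prop :=
  exists (f : X -> Y) (g : Y -> X),
    [/\ continuous f, continuous g, cancel f g & cancel g f].

Section Homotopy.
Variable R : realType.

(* The homotopy parameter ranges over the whole line, but only the values and
   the continuity on [X * [0, 1]] matter. *)
Definition homotopic (X Y : topologicalType) (f g : X -> Y) : Prop :=
  exists H : X * R -> Y,
    [/\ {within [set: X] `*` [set t : R | 0 <= t <= 1], continuous H},
        forall x, H (x, 0) = f x & forall x, H (x, 1) = g x].

Definition homotopy_equivalence (X Y : topologicalType) (f : X -> Y) : Prop :=
  continuous f /\
  exists g : Y -> X,
    [/\ continuous g, homotopic (g \o f) id & homotopic (f \o g) id].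

Definition homotopy_equivalent (X Y : topologicalType) : Prop :=
  exists f : X -> Y, homotopy_equivalence f.

End Homotopy.

Section SpheresDiscs.
Variables (R : realType) (m : nat).

Definition sqnorm (x : 'rV[R]_m) : R := \sum_i x 0 i ^+ 2.

(* The sphere and the disc are indexed by the dimension of the ambient space:
   [usphere m] is S^(m-1) and [udisc m] is D^m. *)
Definition usphere : set 'rV[R]_m := [set x | sqnorm x = 1].
Definition udisc : set 'rV[R]_m := [set x | sqnorm x <= 1].

Lemma usphere_sub_udisc (x : usphere) : udisc (set_val x).
Proof. by have := set_mem (valP x); rewrite /udisc /usphere /= => ->. Qed.

Definition sphere_incl (x : usphere) : udisc :=
  exist _ (set_val x) (mem_set (usphere_sub_udisc x)).

End SpheresDiscs.

Arguments usphere : clear implicits.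
Arguments udisc : clear implicits.

(* The space of self homotopy equivalences of S^(m-1), with the compact-open
   topology; F(2n) is [self_equivs R (2 * n)]. *)
Definition self_equivs (R : realType) (m : nat) :
    set {compact-open, usphere R m -> usphere R m} :=
  [set f | homotopy_equivalence R (f : usphere R m -> usphere R m)].

Arguments self_equivs : clear implicits.

Section CW.
Variable R : realType.

Definition open_cell (k : nat) (X : topologicalType) (chi : udisc R k -> X) :
  set X := [set chi x | x in [set x | sqnorm (set_val x) < 1]].

(* A finite CW structure in Whitehead's sense; for finitely many cells, closure
   finiteness and the weak topology follow from the Hausdorff property. *)
Record finite_CW (X : topologicalType) := FiniteCW {
  cw_cell : finType;
  cw_cell_dim : cw_cell -> nat;
  cw_char : forall e : cw_cell, udisc R (cw_cell_dim e) -> X;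
  cw_hausdorff : hausdorff_space X;
  cw_char_continuous : forall e, continuous (@cw_char e);
  cw_char_inj : forall e (x y : udisc R (cw_cell_dim e)),
    sqnorm (set_val x) < 1 -> sqnorm (set_val y) < 1 ->
    cw_char x = cw_char y -> x = y;
  cw_cover : forall p : X, exists e, open_cell (@cw_char e) p;
  cw_disjoint : forall e e' (p : X),
    open_cell (@cw_char e) p -> open_cell (@cw_char e') p -> e = e';
  cw_boundary : forall e (x : udisc R (cw_cell_dim e)),
    sqnorm (set_val x) = 1 ->
    exists2 e', (cw_cell_dim e' < cw_cell_dim e)%N
              & open_cell (@cw_char e') (cw_char x)
}.

Definition cw_dim (X : topologicalType) (C : finite_CW X) : nat :=
  \max_(e : cw_cell C) cw_cell_dim e.

(* [N_0 \cup_g D^m] for an attaching map [g : S^(m-1) -> N_0] *)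
Definition attach_cell (m : nat) (N0 : topologicalType) (g : usphere R m -> N0) :
  topologicalType := pushout g (@sphere_incl R m).

End CW.

Section Singular.
Variable R : realType.

Definition simplex (k : nat) : set 'rV[R]_k.+1 :=
  [set x | (forall i, 0 <= x 0 i) /\ \sum_i x 0 i = 1].

Arguments simplex : clear implicits.

Section SimplexMap.
Variables (j k : nat) (f : 'I_j.+1 -> 'I_k.+1).

Definition simplex_map_fun (x : 'rV[R]_j.+1) : 'rV[R]_k.+1 :=
  \row_l \sum_(i | f i == l) x 0 i.

Lemma simplex_map_proof (x : simplex j) : simplex k (simplex_map_fun (set_val x)).
Proof.
have [x0 x1] := set_mem (valP x); split=> [l|].
  by rewrite mxE sumr_ge0.
under eq_bigr do rewrite mxE.
by rewrite -x1 (partition_big f xpredT).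
Qed.

(* The affine map of standard simplices sending the vertex [i] to [f i] *)
Definition simplex_map (x : simplex j) : simplex k :=
  exist _ (simplex_map_fun (set_val x)) (mem_set (simplex_map_proof x)).

Lemma simplex_map_continuous : continuous simplex_map.
Proof.
apply: continuous_comp_initial => x U [P nP PU].
have P' l : \forall y \near x, P 0 l (simplex_map_fun (set_val y) 0 l).
  have : continuous (fun y : simplex j => \sum_(i | f i == l) set_val y 0 i).
    apply: continuous_big; first exact: add_continuous.
    move=> i _ y; apply: (@continuous_comp _ _ _ (set_val : simplex j -> _)
      (fun M : 'rV[R]_j.+1 => M 0 i)); first exact: initial_continuous.
    exact: coord_continuous.
  have nPl : nbhs (\sum_(i | f i == l) set_val x 0 i) (P 0 l).
    by have := nP 0 l; rewrite mxE.
  move=> /(_ x _ nPl); apply: (@filterS _ (nbhs x)) => y /=; by rewrite mxE.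
have : \forall y \near x, forall l, P 0 l (simplex_map_fun (set_val y) 0 l).
  exact: (@filter_forall _ _ _ (nbhs x)).
apply: (@filterS _ (nbhs x)) => y yP; apply: PU => a b; rewrite (ord1 a); exact: yP.
Qed.

HB.instance Definition _ :=
  isContinuous.Build _ _ simplex_map simplex_map_continuous.

End SimplexMap.

Variable X : topologicalType.

Definition sing (k : nat) : choiceType := continuousType (simplex k) X.

Definition sing_map (j k : nat) (f : 'I_j.+1 -> 'I_k.+1) (s : sing k) : sing j :=
  (s : continuousType (simplex k) X) \o simplex_map f.

Definition face (k : nat) (i : 'I_k.+2) : sing k.+1 -> sing k :=
  sing_map (fintype.lift i).

Definition chain (k : nat) : lmodType int := {freeg (sing k) / int}.
Definition cochain (k : nat) : Type := sing k -> int.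

Definition gen (k : nat) (s : sing k) : chain k := Freeg [:: (1, s)].

Definition bdry (k : nat) : chain k.+1 -> chain k :=
  fglift (fun s => \sum_(i < k.+2) (-1) ^+ i *: gen (face i s)).

Definition cobdry (k : nat) (phi : cochain k) : cochain k.+1 :=
  fun s => \sum_(i < k.+2) (-1) ^+ i * phi (face i s).

Definition is_cycle (k : nat) : chain k -> Prop :=
  match k with 0 => fun=> True | k'.+1 => fun c => bdry c = 0 end.

Definition homologous (k : nat) (c c' : chain k) : Prop :=
  exists b : chain k.+1, c - c' = bdry b.

Definition is_cocycle (k : nat) (phi : cochain k) : Prop :=
  forall s, cobdry phi s = 0.

Definition is_coboundary (k : nat) : cochain k -> Prop :=
  match k with
  | 0 => fun phi => forall s, phi s = 0
  | k'.+1 => fun phi => exists psi : cochain k', forall s, phi s = cobdry psi s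
  end.

(* Front [p]-face and back [(d - p)]-face of a [d]-simplex, for [p <= d] *)
Definition front (d p : nat) : sing d -> sing p :=
  sing_map (fun i : 'I_p.+1 => inord i).
Definition back (d p : nat) : sing d -> sing (d - p) :=
  sing_map (fun i : 'I_(d - p).+1 => inord (p + i)).

Definition cap (d p : nat) (c : chain d) (phi : cochain p) : chain (d - p) :=
  fglift (fun s => phi (front p s) *: gen (back p s)) c.

(* Capping with the class of the cycle [z] is an isomorphism
   [H^p(X; Z) -> H_(d-p)(X; Z)] for every [p <= d]: the first clause is
   injectivity and the second one is surjectivity. *)
Definition is_fundamental_cycle (d : nat) (z : chain d) : Prop :=
  is_cycle z /\
  forall p, (p <= d)%N ->
    (forall phi : cochain p, is_cocycle phi ->
       homologous (cap z phi) 0 -> is_coboundary phi) /\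
    (forall c : chain (d - p), is_cycle c ->
       exists2 phi : cochain p, is_cocycle phi & homologous c (cap z phi)).

End Singular.

Definition poincare_duality_complex (R : realType) (d : nat)
    (N : topologicalType) : Prop :=
  [/\ [set: N] !=set0, connected [set: N],
      exists C : finite_CW R N, cw_dim C = d
    & exists z : chain R N d, is_fundamental_cycle z].

Section Gyration.
Variables (R : realType) (n : nat) (N0 : topologicalType).
Variables (g : usphere R (2 * n) -> N0) (tau : usphere R n -> self_equivs R (2 * n)).

Definition gyration_twist (p : usphere R (2 * n) * usphere R n) :
  usphere R (2 * n) * usphere R n := (set_val (tau p.2) p.1, p.2).

Definition gyration_phi : usphere R (2 * n) * usphere R n -> N0 :=
  g \o fst \o gyration_twist.

Definition gyration_left (p : usphere R (2 * n) * usphere R n) :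
  N0 * usphere R n := (gyration_phi p, p.2).

Definition gyration_right (p : usphere R (2 * n) * usphere R n) :
  usphere R (2 * n) * udisc R n := (p.1, sphere_incl p.2).

Definition gyration : topologicalType := pushout gyration_left gyration_right.

(* The complement of the point of the gyration represented by
   [p \in S^(2n-1) * D^n] *)
Definition gyration_minus (p : usphere R (2 * n) * udisc R n) : set gyration :=
  [set~ pushout_inr gyration_left gyration_right p].

End Gyration.

Arguments gyration_minus {R n N0} g tau p _.

(* Main.v *)
Require Import Defs.
From mathcomp Require Import all_boot all_order all_algebra.
From mathcomp Require Import all_classical all_reals all_analysis.
From mathcomp Require Import ring lra zify.
From Stdlib Require Import Relation_Operators.

(** Write [S] for the sphere of dimension [2n - 1], [B] for the sphere of
dimension [n - 1] bounding the disc [D], and let [(y, v)] be the removed point.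

The product [S * D] without [(y, v)] deforms onto the union of [S * B] and the
disc over the antipode of [y]: away from the removed point one can slide towards
the antipode in [S] and push radially away from [v] in [D], and near every point
at least one of the two motions may be completed. Since [S * B] is glued to
[N0 * B], the punctured gyration is homotopy equivalent to [N0 * B] with one
[n]-cell attached along [s |-> (g (tau s (- y)), s)]
([punctured_gyration_attach_cell]).

The homotopy type of this space only depends on the homotopy class of the
attaching map ([attach_cell_homotopic]). The map [s |-> tau s (- y)] goes from a
sphere to a sphere of higher dimension; it is nullhomotopic
([sphere_map_nullhomotopic]), because it is approximated by a map with
values in finitely many proper subspaces, which misses a direction. The space
[N0] is path connected: it is connected, as [N] is connected and the sphere
bounding the top cell is, and its path components are open. So the attaching map
may be replaced by [s |-> (pt, s)], and this is where [tau] disappears.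

A cell attached along the fibre [pt * B] is contractible, and collapsing it
gives the half smash product ([attach_fibre_half_smash]). Collapsing is a
homotopy equivalence because [pt] has the homotopy extension property in [N0],
which is proved by adding the cells of [N0] one at a time
([cw_nondegenerate]).

Continuity on attaching spaces, on their products with the parameter line and on
the discs is always checked after composition with an identification map, using
polar coordinates centred at [v]. The equivalence works with homotopies whose
parameter runs over the whole line. *)

Set Implicit Arguments.
Unset Strict Implicit.
Unset Printing Implicit Defensive.

Import Order.TTheory GRing.Theory Num.Theory.
Import numFieldNormedType.Exports.
Local Open Scope classical_set_scope.
Local Open Scope ring_scope.

(** * Continuity at a point *)

Section ContinuityAt.
Variable R : realType.
Implicit Types T U V W : topologicalType.

Lemma at_cst T U (c : U) (x : T) : {for x, continuous (fun=> c)}.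
Proof. exact: cvg_cst. Qed.

Lemma at_id T (x : T) : {for x, continuous id}.
Proof. exact: cvg_id. Qed.

Lemma at_comp T U V (f : T -> U) (g : U -> V) (x : T) :
  {for x, continuous f} -> {for f x, continuous g} ->
  {for x, continuous (fun z => g (f z))}.
Proof. exact: continuous_comp. Qed.

Lemma comp_continuous T U V (f : T -> U) (g : U -> V) :
  continuous f -> continuous g -> continuous (g \o f).
Proof. by move=> cf cg x; apply: (at_comp (cf x)); exact: cg. Qed.

Lemma at_pair T U V (f : T -> U) (g : T -> V) (x : T) :
  {for x, continuous f} -> {for x, continuous g} ->
  {for x, continuous (fun z => (f z, g z))}.
Proof. by move=> cf cg; exact: cvg_pair. Qed.

Lemma at_fst T U V (f : T -> U * V) (x : T) :
  {for x, continuous f} -> {for x, continuous (fun z => (f z).1)}.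
Proof. by move=> cf; apply: (at_comp cf); exact: cvg_fst. Qed.

Lemma at_snd T U V (f : T -> U * V) (x : T) :
  {for x, continuous f} -> {for x, continuous (fun z => (f z).2)}.
Proof. by move=> cf; apply: (at_comp cf); exact: cvg_snd. Qed.

Lemma at_proj1 T U (x : T * U) : {for x, continuous fst}.
Proof. exact: cvg_fst. Qed.

Lemma at_proj2 T U (x : T * U) : {for x, continuous snd}.
Proof. exact: cvg_snd. Qed.

Lemma at_eq_near T U (f g : T -> U) (x : T) :
  (\forall z \near x, f z = g z) ->
  {for x, continuous f} -> {for x, continuous g}.
Proof.
move=> fg cf; rewrite /prop_for /continuous_at -(nbhs_singleton fg).
by apply: cvg_trans cf; apply: near_eq_cvg; apply: filterS fg => z ->.
Qed.

Lemma at_eq T U (f g : T -> U) (x : T) :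
  f =1 g -> {for x, continuous f} -> {for x, continuous g}.
Proof. by move=> fg; apply: at_eq_near; exact: nearW. Qed.

Section Algebra.
Variables (T : topologicalType) (x : T).

Lemma at_add (V : normedModType R) (f g : T -> V) :
  {for x, continuous f} -> {for x, continuous g} ->
  {for x, continuous (fun z => f z + g z)}.
Proof. by move=> cf cg; exact: cvgD. Qed.

Lemma at_opp (V : normedModType R) (f : T -> V) :
  {for x, continuous f} -> {for x, continuous (fun z => - f z)}.
Proof. by move=> cf; exact: cvgN. Qed.

Lemma at_scale (V : normedModType R) (k : T -> R) (f : T -> V) :
  {for x, continuous k} -> {for x, continuous f} ->
  {for x, continuous (fun z => k z *: f z)}.
Proof. by move=> ck cf; exact: cvgZ. Qed.

Lemma at_mul (f g : T -> R) :
  {for x, continuous f} -> {for x, continuous g} ->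
  {for x, continuous (fun z => f z * g z)}.
Proof. by move=> cf cg; exact: cvgM. Qed.

Lemma at_inv (f : T -> R) : f x != 0 ->
  {for x, continuous f} -> {for x, continuous (fun z => (f z)^-1)}.
Proof. by move=> f0 cf; exact: cvgV. Qed.

Lemma at_max (f g : T -> R) :
  {for x, continuous f} -> {for x, continuous g} ->
  {for x, continuous (fun z => Num.max (f z) (g z))}.
Proof. by move=> cf cg; exact: continuous_max. Qed.

Lemma at_min (f g : T -> R) :
  {for x, continuous f} -> {for x, continuous g} ->
  {for x, continuous (fun z => Num.min (f z) (g z))}.
Proof. by move=> cf cg; exact: continuous_min. Qed.

End Algebra.

Lemma at_coord T m (f : T -> 'rV[R]_m) (i : 'I_m) (x : T) :
  {for x, continuous f} -> {for x, continuous (fun z => f z 0 i)}.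
Proof.
move=> cf; apply: (@at_comp _ _ _ f (fun M : 'rV[R]_m => M 0 i)) => //.
exact: coord_continuous.
Qed.

Lemma at_row T m (f : T -> 'rV[R]_m) (x : T) :
  (forall i, {for x, continuous (fun z => f z 0 i)}) -> {for x, continuous f}.
Proof.
move=> cf U [P nP PU].
have : \forall z \near x, forall i, P 0 i (f z 0 i).
  apply: (@filter_forall _ _ _ (nbhs x)) => i; exact: cf (nP 0 i).
apply: filterS => z Pz; apply: PU => a b.
by rewrite (ord1 a); exact: Pz.
Qed.

Lemma at_sum T I (r : seq I) (F : I -> T -> R) (x : T) :
  (forall i, {for x, continuous (F i)}) ->
  {for x, continuous (fun z => \sum_(i <- r) F i z)}.
Proof.
move=> cF; elim: r => [|i r IH].
  by apply: (@at_eq _ _ (fun=> 0 : R)) => [z|]; rewrite ?big_nil //; exact: at_cst.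
apply: (@at_eq _ _ (fun z => F i z + \sum_(i <- r) F i z)) => [z|].
  by rewrite big_cons.
exact: at_add.
Qed.

Lemma at_prod T I (r : seq I) (F : I -> T -> R) (x : T) :
  (forall i, {for x, continuous (F i)}) ->
  {for x, continuous (fun z => \prod_(i <- r) F i z)}.
Proof.
move=> cF; elim: r => [|i r IH].
  by apply: (@at_eq _ _ (fun=> 1 : R)) => [z|]; rewrite ?big_nil //; exact: at_cst.
apply: (@at_eq _ _ (fun z => F i z * \prod_(i <- r) F i z)) => [z|].
  by rewrite big_cons.
exact: at_mul.
Qed.

Lemma at_set_type T U (A : set U) (f : T -> A) (x : T) :
  {for x, continuous (fun z => set_val (f z))} -> {for x, continuous f}.
Proof.
move=> cf V /= [_ [[W oW <-] Wfx] WV].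
have nW : nbhs (set_val (f x)) W by rewrite nbhsE; exists W.
by move: (cf W nW); apply: (@filterS _ (nbhs x)) => z; exact: WV.
Qed.

Lemma at_set_val T U (A : set U) (f : T -> A) (x : T) :
  {for x, continuous f} -> {for x, continuous (fun z => set_val (f z))}.
Proof. by move=> cf; apply: (at_comp cf); exact: initial_continuous. Qed.

Lemma at_lt T (a b : T -> R) (x : T) :
  {for x, continuous a} -> {for x, continuous b} -> a x < b x ->
  \forall z \near x, a z < b z.
Proof.
move=> ca cb ab.
have cd : {for x, continuous (fun z => b z - a z)}.
  by apply: at_add => //; exact: at_opp.
have /cd : nbhs (b x - a x) [set t : R | 0 < t].
  by apply: open_nbhs_nbhs; split; [exact: open_gt|rewrite /= subr_gt0].
by apply: (@filterS _ (nbhs x)) => z /=; rewrite subr_gt0.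
Qed.

(** Two functions may be pasted along the locus where [a] and [b] agree: only
the branches that are active at the point have to be continuous there. *)
Lemma at_if T U (a b : T -> R) (f g : T -> U) (x : T) :
  {for x, continuous a} -> {for x, continuous b} ->
  (a x <= b x -> {for x, continuous f}) ->
  (b x <= a x -> {for x, continuous g}) ->
  (a x = b x -> f x = g x) ->
  {for x, continuous (fun z => if a z <= b z then f z else g z)}.
Proof.
move=> ca cb cf cg fg; case: (ltgtP (a x) (b x)) => ab.
- apply: at_eq_near (cf (ltW ab)).
  by apply: filterS (at_lt ca cb ab) => z /ltW ->.
- apply: at_eq_near (cg (ltW ab)).
  by apply: filterS (at_lt cb ca ab) => z; rewrite leNgt => ->.
- move: cf cg; rewrite ab lexx => /(_ isT) cf /(_ isT) cg U' /=.
  rewrite ab lexx => nU; have {}fg := fg ab.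
  have nf := cf _ nU; rewrite fg in nU; have ng := cg _ nU.
  by apply: (@filterS2 _ (nbhs x)) nf ng => z /= ? ?; case: ifP.
Qed.

Lemma at_within T U V (A : set U) (f : T -> U) (g : U -> V) (x : T) :
  {within A, continuous g} -> {for x, continuous f} ->
  (\forall z \near x, A (f z)) -> {for x, continuous (fun z => g (f z))}.
Proof.
move=> /subspace_continuousP cg cf Af W nW.
have Afx := nbhs_singleton Af; have := cf _ (cg _ Afx _ nW).
by move=> /= nfW; apply: (@filterS2 _ (nbhs x)) Af nfW => z /= Az; exact.
Qed.

End ContinuityAt.

(* Continuity of an expression built from the operations above, by recursion on
its syntax *)
Ltac cts_head f :=
  lazymatch f with
  | fst => exact (@at_proj1 _ _ _)
  | snd => exact (@at_proj2 _ _ _)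
  | @set_val _ ?A => exact (@at_set_val _ _ A id _ (@at_id _ _))
  | -%R => apply: (@at_opp _ _ _ _ (fun z => z))
  | *%R ?k => apply: (@at_mul _ _ _ (fun=> k) (fun z => z))
  | (fun z => (@?f z, @?g z)) => apply: at_pair
  | (fun z => (@?f z).1) => apply: at_fst
  | (fun z => (@?f z).2) => apply: at_snd
  | (fun z => fun_of_matrix (@?f z) ?a ?i) => apply: at_coord
  | (fun z => set_val (@?f z)) => apply: at_set_val
  | (fun z => Num.max (@?f z) (@?g z)) => apply: at_max
  | (fun z => Num.min (@?f z) (@?g z)) => apply: at_min
  | (fun z => (@?f z) + (@?g z)) => apply: at_add
  | (fun z => - (@?f z)) => apply: at_opp
  | (fun z => (@?f z) *: (@?g z)) => apply: at_scale
  | (fun z => (@?f z) * (@?g z)) => apply: at_mul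
  end.

Ltac eta_eq f g :=
  lazymatch g with
  | (fun z => ?h z) => constr_eq f h
  | _ => constr_eq f g
  end.

Ltac cts :=
  match goal with
  | |- continuous_at ?x ?f => change {for x, continuous f}
  | |- _ => idtac
  end;
  cbv beta;
  first
    [ match goal with
        H : {for _, continuous ?f} |- {for _, continuous ?g} =>
          eta_eq f g; exact H end
    | lazymatch goal with
      | |- {for ?x, continuous (fun z => z)} => exact (@at_id _ x)
      | |- {for ?x, continuous (fun z => ?c)} => exact (@at_cst _ _ c x)
      end
    | match goal with
        H : continuous ?f |- {for ?x, continuous ?g} =>
          eta_eq f g; exact (H x) end
    | match goal with
        H : continuous ?f |- {for ?x, continuous (fun z => ?h (@?g z))} =>
          constr_eq f h; apply: (@at_comp _ _ _ g f x); [cts|exact (H (g x))] end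
    | lazymatch goal with
        |- {for ?x, continuous ?f} => cts_head f; try cts
      end ].

(** * Identification maps *)

Section Identification.
Variable R : realType.
Implicit Types T Q X Y : topologicalType.

Definition identification T Q (q : T -> Q) : Prop :=
  (forall x, exists t, q t = x) /\ forall U : set Q, open (q @^-1` U) <-> open U.

Lemma identification_continuous T Q (q : T -> Q) :
  identification q -> continuous q.
Proof. by move=> [_ oq]; apply/continuousP => U /oq. Qed.

(** Whitehead's theorem that [q * id] is an identification when the second
factor is locally compact, over an open part of the quotient: the tube lemma
over a compact neighbourhood of the parameter. *)
Lemma identification_homotopy T Q Y (q : T -> Q) (O : set Q) (H : Q * R -> Y) :
  identification q -> open O ->
  (forall t r, O (q t) -> {for (t, r), continuous (fun p => H (q p.1, p.2))}) ->
  forall x r, O x -> {for (x, r), continuous H}.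
Proof.
move=> iq oO cH x r; have [sq oq] := iq; have cq := identification_continuous iq.
have [t <-{x}] := sq x => Ox W nW.
have := cH t r Ox (W°) (nbhs_interior nW).
move=> [[/= A B] [nA /nbhs_ballP[e /= e0 eB]] AB].
pose K : set R := `[r - e / 2, r + e / 2]%classic.
have KB : K `<=` B.
  move=> k; rewrite /K /= in_itv /= => /andP[k1 k2]; apply: eB.
  rewrite /ball /= ltr_distlC; apply/andP; split; lra.
pose V := [set x' | O x' /\ forall k, K k -> W° (H (x', k))].
have oV : open V.
  apply/oq; rewrite openE => t' [Ot' Kt'].
  have nO : \forall t'' \near t', O (q t'').
    by apply: cq; exact: open_nbhs_nbhs.
  have : \forall t'' \near t', K `<=` [set k | W° (H (q t'', k))].
    have /compact_near_coveringP/near_covering_withinP :=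
      @segment_compact R (r - e / 2) (r + e / 2).
    apply=> k Kk.
    have := cH t' k Ot' (W°) (open_nbhs_nbhs (conj (@open_interior _ _) (Kt' k Kk))).
    move=> [[/= A' B'] [nA' nB'] AB']; exists (B', A') => //= -[b a] /= [B'b A'a] _.
    exact: (AB' (a, b)).
  by rewrite /interior; apply: filterS2 nO => t'' /= ? ?; split.
have nV : nbhs (q t) V.
  apply: open_nbhs_nbhs; split=> //; split=> // k Kk.
  by apply: (AB (t, k)); split; [exact: nbhs_singleton nA|exact: KB].
exists (V, K); first split=> //=.
  apply/nbhs_ballP; exists (e / 2) => /=; first lra.
  move=> k; rewrite /ball /= ltr_distlC => /andP[k1 k2].
  by rewrite /K /= in_itv /=; apply/andP; split; lra.
by move=> [a k] /= [[_ Va] Kk]; apply: interior_subset; exact: Va.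
Qed.

Lemma identification_at T Q Y (q : T -> Q) (O : set Q) (f : Q -> Y) :
  identification q -> open O ->
  (forall t, O (q t) -> {for t, continuous (fun z => f (q z))}) ->
  forall x, O x -> {for x, continuous f}.
Proof.
move=> iq oO cf x Ox.
have := @identification_homotopy _ _ _ _ O (fun p => f p.1) iq oO _ x 0 Ox.
move=> H; apply: (@at_comp _ _ _ (fun z => (z, 0 : R)) (fun p => f p.1)).
  by cts.
apply: H => t r Ot; apply: (@at_comp _ _ _ fst (fun z => f (q z)) (t, r)).
  exact: cvg_fst.
exact: cf.
Qed.

(** A continuous surjection from a compact set to a Hausdorff space is closed. *)
Lemma compact_identification T Q (q : T -> Q) (C : set T) :
  hausdorff_space Q -> continuous q -> compact C ->
  (forall x, exists2 t, C t & q t = x) -> identification q.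
Proof.
move=> hQ cq cC sq; split=> [x|U]; first by have [t _ <-] := sq x; exists t.
split=> [oU|oU]; last by move/continuousP : cq; exact.
rewrite -(setCK U); apply: closed_openC.
have -> : ~` U = q @` (C `&` q @^-1` (~` U)).
  apply/seteqP; split=> [x Ux|_ [t [_ Ut] <-]] //.
  by have [t Ct tx] := sq x; exists t => //; split=> //=; rewrite tx.
apply: compact_closed => //; apply: continuous_compact.
  exact: continuous_subspaceT.
apply: compact_closedI => //.
by rewrite preimage_setC; apply: open_closedC.
Qed.

(** The map from the compact set to its image is closed, hence an identification
onto the image. *)
Lemma compact_image_within T Q Y (q : T -> Q) (C : set T) (f : Q -> Y) :
  hausdorff_space Q -> {within C, continuous q} -> compact C ->
  {within C, continuous (f \o q)} -> {within q @` C, continuous f}.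
Proof.
move=> hQ cq cC cfq; apply/continuous_closedP => D cD.
apply/closed_subspaceP; exists (q @` (C `&` (f \o q) @^-1` D)).
  apply: compact_closed => //; apply: continuous_compact.
    by apply: continuous_subspaceW cq => t [].
  move/continuous_closedP: cfq => /(_ _ cD) /closed_subspaceP [V cV VE].
  by rewrite setIC -VE setIC; exact: compact_closedI.
apply/seteqP; split=> [x [[t [Ct Dt] <-] _]|x [Dx [t Ct tx]]].
  by split=> //; exists t.
by split; exists t => //; split=> //=; rewrite /from_subspace /= tx.
Qed.

End Identification.

(** * Quotients and pushouts *)

Section QuotientLift.
Variables (T : topologicalType) (r : T -> T -> Prop).

Lemma quot_proj_identification : identification (quot_proj r).
Proof.
split=> [x|U]; last by [].
by exists (repr x); rewrite /quot_proj reprK.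
Qed.

Lemma quot_proj_eq (u v : T) : r u v -> quot_proj r u = quot_proj r v.
Proof. by move=> ruv; apply/eqmodP/asboolP; exact: rst_step. Qed.

Definition quot_lift (Y : Type) (f : T -> Y) (x : quot_space r) : Y := f (repr x).

Lemma quot_liftE (Y : Type) (f : T -> Y) (u : T) :
  (forall u v, r u v -> f u = f v) -> quot_lift f (quot_proj r u) = f u.
Proof.
move=> rf; rewrite /quot_lift /quot_proj.
set v := repr _.
have /eqmodP/asboolP : v = u %[mod {eq_quot gen_equiv_rel r}]%qT by rewrite reprK.
by elim=> [a b /rf|//|a b _ ->|a b c _ -> _ ->].
Qed.

End QuotientLift.

Section SumAt.
Variables (R : realType) (X Y Z : topologicalType).

Lemma inl_continuous : continuous (inl : X -> X + Y).
Proof. by apply/continuousP => U []. Qed.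

Lemma inr_continuous : continuous (inr : Y -> X + Y).
Proof. by apply/continuousP => U []. Qed.

Lemma nbhs_inl (x : X) (A : set (X + Y)) : nbhs x (inl @^-1` A) -> nbhs (inl x) A.
Proof.
rewrite !nbhsE /= => -[U [oU Ux] UA]; exists (inl @` U); last first.
  by move=> _ [z Uz <-]; exact: UA.
split; last by exists x.
split.
  suff -> : (inl : X -> X + Y) @^-1` (inl @` U) = U by [].
  by apply/seteqP; split=> [z [w Uw [<-]]|z Uz] //; exists z.
suff -> : (inr : Y -> X + Y) @^-1` (inl @` U) = set0 by exact: open0.
by apply/seteqP; split=> // z [].
Qed.

Lemma nbhs_inr (y : Y) (A : set (X + Y)) : nbhs y (inr @^-1` A) -> nbhs (inr y) A.
Proof.
rewrite !nbhsE /= => -[U [oU Uy] UA]; exists (inr @` U); last first.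
  by move=> _ [z Uz <-]; exact: UA.
split; last by exists y.
split; last first.
  suff -> : (inr : Y -> X + Y) @^-1` (inr @` U) = U by [].
  by apply/seteqP; split=> [z [w Uw [<-]]|z Uz] //; exists z.
suff -> : (inl : X -> X + Y) @^-1` (inr @` U) = set0 by exact: open0.
by apply/seteqP; split=> // z [].
Qed.

Lemma at_inl (F : (X + Y) * R -> Z) (x : X) (r : R) :
  {for (x, r), continuous (fun p => F (inl p.1, p.2))} ->
  {for (inl x, r), continuous F}.
Proof.
move=> cF W /cF [[/= A B] [nA nB] AB].
exists (inl @` A, B); first split=> //=.
  by apply: nbhs_inl; apply: filterS nA => z; exists z.
by move=> [_ b] /= [[a Aa <-] Bb]; exact: (AB (a, b)).
Qed.

Lemma at_inr (F : (X + Y) * R -> Z) (y : Y) (r : R) :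
  {for (y, r), continuous (fun p => F (inr p.1, p.2))} ->
  {for (inr y, r), continuous F}.
Proof.
move=> cF W /cF [[/= A B] [nA nB] AB].
exists (inr @` A, B); first split=> //=.
  by apply: nbhs_inr; apply: filterS nA => z; exists z.
by move=> [_ b] /= [[a Aa <-] Bb]; exact: (AB (a, b)).
Qed.

End SumAt.

Section PushoutRec.
Variables (A X Y : topologicalType) (f : A -> X) (g : A -> Y).

Lemma pushout_glue (a : A) : pushout_inl f g (f a) = pushout_inr f g (g a).
Proof. by apply: quot_proj_eq; exists a. Qed.

Definition pushout_rec (Z : Type) (h : X -> Z) (k : Y -> Z) : pushout f g -> Z :=
  quot_lift (fun u => match u with inl x => h x | inr y => k y end).

Section RecE.
Variables (Z : Type) (h : X -> Z) (k : Y -> Z).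
Hypothesis hk : forall a, h (f a) = k (g a).

Let compat (u v : X + Y) : pushout_rel f g u v ->
  match u with inl x => h x | inr y => k y end =
  match v with inl x => h x | inr y => k y end.
Proof. by move=> [a [-> ->]]. Qed.

Lemma pushout_rec_inl x : pushout_rec h k (pushout_inl f g x) = h x.
Proof. exact: (quot_liftE (inl x) compat). Qed.

Lemma pushout_rec_inr y : pushout_rec h k (pushout_inr f g y) = k y.
Proof. exact: (quot_liftE (inr y) compat). Qed.
End RecE.

Definition pushout_cover (Y' : topologicalType) (p : Y' -> Y) (u : X + Y') :
    pushout f g :=
  match u with inl x => pushout_inl f g x | inr y => pushout_inr f g (p y) end.

Lemma pushout_cover_identification (Y' : topologicalType) (p : Y' -> Y) :
  identification p -> identification (pushout_cover p).
Proof.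
move=> [sp op]; have [sq oq] := quot_proj_identification (pushout_rel f g).
split=> [w|U].
  have [[x|y] <-] := sq w; first by exists (inl x).
  by have [y' <-] := sp y; exists (inr y').
rewrite -oq; split=> -[oX oY]; split=> //.
  by apply/op.
by move/op: oY.
Qed.

Lemma pushout_inl_continuous : continuous (pushout_inl f g).
Proof.
move=> x; apply: (@at_comp _ _ _ inl (quot_proj (pushout_rel f g))).
  exact: inl_continuous.
exact: (identification_continuous (quot_proj_identification _)).
Qed.

Lemma pushout_inr_continuous : continuous (pushout_inr f g).
Proof.
move=> x; apply: (@at_comp _ _ _ inr (quot_proj (pushout_rel f g))).
  exact: inr_continuous.
exact: (identification_continuous (quot_proj_identification _)).
Qed.

Lemma pushout_ind (P : pushout f g -> Prop) :
  (forall x, P (pushout_inl f g x)) -> (forall y, P (pushout_inr f g y)) ->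
  forall w, P w.
Proof.
move=> Pl Pr w; have [[x|y] <-] := (quot_proj_identification (pushout_rel f g)).1 w.
  exact: Pl.
exact: Pr.
Qed.

End PushoutRec.

(** * Homotopies over the whole line *)

Section LineHomotopy.
Variable R : realType.
Implicit Types X Y Z : topologicalType.

(** Homotopies that are continuous on all of [X * R] compose and paste without
any bookkeeping of the parameter interval. *)
Definition line_homotopic X Y (f g : X -> Y) : Prop :=
  exists H : X * R -> Y,
    [/\ continuous H, forall x, H (x, 0) = f x & forall x, H (x, 1) = g x].

Lemma line_homotopic_refl X Y (f : X -> Y) : continuous f -> line_homotopic f f.
Proof.
by move=> cf; exists (fun p => f p.1); split=> // p; cts.
Qed.

Lemma line_homotopic_sym X Y (f g : X -> Y) :
  line_homotopic f g -> line_homotopic g f.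
Proof.
move=> [H [cH H0 H1]]; exists (fun p => H (p.1, 1 - p.2)); split=> [p|x|x] /=.
- by cts.
- by rewrite subr0.
- by rewrite subrr.
Qed.

Lemma line_homotopic_trans X Y (g f h : X -> Y) :
  line_homotopic f g -> line_homotopic g h -> line_homotopic f h.
Proof.
move=> [H [cH H0 H1]] [K [cK K0 K1]].
exists (fun p => if p.2 <= 1 / 2 then H (p.1, 2 * p.2) else K (p.1, 2 * p.2 - 1)).
split=> [p|x|x] /=.
- apply: (@at_if R _ _ snd (fun=> 1 / 2)) => [||_|_|p2].
  + by cts.
  + by cts.
  + by cts.
  + by cts.
  + by rewrite p2 mulrCA divff // mulr1 subrr H1 K0.
- by rewrite mulr0 H0 ifT //; lra.
- rewrite ifF; last by apply/negbTE; rewrite -ltNge; lra.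
  by rewrite (_ : 2 * 1 - 1 = 1 :> R) ?K1 //; lra.
Qed.

Lemma line_homotopic_comp X Y Z (f f' : X -> Y) (g g' : Y -> Z) :
  line_homotopic f f' -> line_homotopic g g' ->
  line_homotopic (g \o f) (g' \o f').
Proof.
move=> [H [cH H0 H1]] [K [cK K0 K1]]; exists (fun p => K (H p, p.2)).
split=> [p|x|x] /=; last 2 first.
- by rewrite H0 K0.
- by rewrite H1 K1.
by apply: (@at_comp _ _ _ (fun p => (H p, p.2)) K); [cts|exact: cK].
Qed.

Lemma line_homotopic_homotopic X Y (f g : X -> Y) :
  line_homotopic f g -> homotopic R f g.
Proof.
by move=> [H [cH H0 H1]]; exists H; split=> //; exact: continuous_subspaceT.
Qed.

Definition line_equivalent X Y : Prop :=
  exists (f : X -> Y) (g : Y -> X),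
    [/\ continuous f, continuous g, line_homotopic (g \o f) id &
        line_homotopic (f \o g) id].

Lemma line_equivalent_trans Y X Z :
  line_equivalent X Y -> line_equivalent Y Z -> line_equivalent X Z.
Proof.
move=> [f [g [cf cg gf fg]]] [f' [g' [cf' cg' gf' fg']]].
exists (f' \o f), (g \o g'); split.
- exact: comp_continuous.
- exact: comp_continuous.
- apply: line_homotopic_trans gf.
  have := line_homotopic_comp (line_homotopic_refl cf)
    (line_homotopic_comp gf' (line_homotopic_refl cg)).
  exact.
- apply: line_homotopic_trans fg'.
  have := line_homotopic_comp (line_homotopic_refl cg')
    (line_homotopic_comp fg (line_homotopic_refl cf')).
  exact.
Qed.

Lemma line_equivalent_homotopy_equivalent X Y :
  line_equivalent X Y -> homotopy_equivalent R X Y.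
Proof.
move=> [f [g [cf cg gf fg]]]; exists f; split=> //; exists g.
by split=> //; exact: line_homotopic_homotopic.
Qed.

End LineHomotopy.

(** * Euclidean geometry of spheres and discs *)

Section Euclid.
Variable R : realType.

Definition dot m (x y : 'rV[R]_m) : R := \sum_i x 0 i * y 0 i.

Lemma dotxx m (x : 'rV[R]_m) : dot x x = sqnorm x.
Proof. by []. Qed.

Lemma dotC m (x y : 'rV[R]_m) : dot x y = dot y x.
Proof. by apply: eq_bigr => i _; rewrite mulrC. Qed.

Lemma dotDl m (x y z : 'rV[R]_m) : dot (x + y) z = dot x z + dot y z.
Proof. by rewrite -big_split; apply: eq_bigr => i _; rewrite mxE mulrDl. Qed.

Lemma dotZl m a (x y : 'rV[R]_m) : dot (a *: x) y = a * dot x y.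
Proof. by rewrite mulr_sumr; apply: eq_bigr => i _; rewrite mxE mulrA. Qed.

Lemma dotDr m (x y z : 'rV[R]_m) : dot z (x + y) = dot z x + dot z y.
Proof. by rewrite !(dotC z) dotDl. Qed.

Lemma dotZr m a (x y : 'rV[R]_m) : dot x (a *: y) = a * dot x y.
Proof. by rewrite !(dotC x) dotZl. Qed.

Lemma dotNl m (x y : 'rV[R]_m) : dot (- x) y = - dot x y.
Proof. by rewrite -scaleN1r dotZl mulN1r. Qed.

Lemma dotNr m (x y : 'rV[R]_m) : dot x (- y) = - dot x y.
Proof. by rewrite !(dotC x) dotNl. Qed.

Lemma sqnormD m (x y : 'rV[R]_m) :
  sqnorm (x + y) = sqnorm x + 2 * dot x y + sqnorm y.
Proof. by rewrite -!dotxx dotDl !dotDr (dotC y x); ring. Qed.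

Lemma sqnormN m (x : 'rV[R]_m) : sqnorm (- x) = sqnorm x.
Proof. by rewrite -!dotxx dotNl dotNr opprK. Qed.

Lemma sqnormB m (x y : 'rV[R]_m) :
  sqnorm (x - y) = sqnorm x - 2 * dot x y + sqnorm y.
Proof. by rewrite sqnormD sqnormN dotNr mulrN. Qed.

Lemma sqnormZ m a (x : 'rV[R]_m) : sqnorm (a *: x) = a ^+ 2 * sqnorm x.
Proof. by rewrite -!dotxx dotZl dotZr mulrA expr2. Qed.

Lemma sqnorm0 m : sqnorm (0 : 'rV[R]_m) = 0.
Proof. by rewrite -(scale0r 0) sqnormZ expr0n mul0r. Qed.

Lemma sqnorm_ge0 m (x : 'rV[R]_m) : 0 <= sqnorm x.
Proof. by apply: sumr_ge0 => i _; exact: sqr_ge0. Qed.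

Lemma sqnorm_eq0 m (x : 'rV[R]_m) : (sqnorm x == 0) = (x == 0).
Proof.
apply/eqP/eqP => [|->]; last exact: sqnorm0.
move/eqP; rewrite psumr_eq0 => [/allP x0|i _]; last exact: sqr_ge0.
apply/rowP => i; rewrite mxE; apply/eqP; rewrite -sqrf_eq0.
by apply: x0; rewrite mem_index_enum.
Qed.

Lemma dot_le m (x y : 'rV[R]_m) : 2 * dot x y <= sqnorm x + sqnorm y.
Proof. by have := sqnorm_ge0 (x - y); rewrite sqnormB; lra. Qed.

Lemma sqnorm_convex m (x y : 'rV[R]_m) (r : R) : 0 <= r <= 1 ->
  sqnorm x <= 1 -> sqnorm y <= 1 -> sqnorm ((1 - r) *: x + r *: y) <= 1.
Proof.
move=> /andP[r0 r1] x1 y1; rewrite sqnormD !sqnormZ dotZl dotZr.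
have p1 : 0 <= (1 - r) * (1 - sqnorm x) by apply: mulr_ge0; lra.
have p2 : 0 <= r * (1 - sqnorm y) by apply: mulr_ge0; lra.
have p3 : 0 <= r * (1 - r) * (sqnorm x + sqnorm y - 2 * dot x y).
  by have := dot_le x y; rewrite -subr_ge0 => /(mulr_ge0 _); apply; rewrite mulr_ge0 //; lra.
lra.
Qed.

Lemma at_dot (T : topologicalType) m (f g : T -> 'rV[R]_m) (x : T) :
  {for x, continuous f} -> {for x, continuous g} ->
  {for x, continuous (fun z => dot (f z) (g z))}.
Proof. by move=> cf cg; apply: at_sum => i; cts. Qed.

Lemma at_sqnorm (T : topologicalType) m (f : T -> 'rV[R]_m) (x : T) :
  {for x, continuous f} -> {for x, continuous (fun z => sqnorm (f z))}.
Proof. by move=> cf; exact: at_dot. Qed.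

Lemma at_sqrt (T : topologicalType) (f : T -> R) (x : T) :
  {for x, continuous f} -> {for x, continuous (fun z => Num.sqrt (f z))}.
Proof. by move=> cf; apply: at_comp cf _; exact: sqrt_continuous. Qed.

Definition enorm m (x : 'rV[R]_m) : R := Num.sqrt (sqnorm x).

Lemma enorm_ge0 m (x : 'rV[R]_m) : 0 <= enorm x.
Proof. exact: sqrtr_ge0. Qed.

Lemma sqr_enorm m (x : 'rV[R]_m) : enorm x ^+ 2 = sqnorm x.
Proof. by rewrite sqr_sqrtr // sqnorm_ge0. Qed.

Lemma enorm_gt0 m (x : 'rV[R]_m) : (0 < enorm x) = (x != 0).
Proof. by rewrite sqrtr_gt0 lt_def sqnorm_ge0 sqnorm_eq0 andbT. Qed.

Lemma at_enorm (T : topologicalType) m (f : T -> 'rV[R]_m) (x : T) :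
  {for x, continuous f} -> {for x, continuous (fun z => enorm (f z))}.
Proof. by move=> cf; apply: at_sqrt; exact: at_sqnorm. Qed.

Lemma usphereE m (x : usphere R m) : sqnorm (set_val x) = 1.
Proof. exact: set_mem (valP x). Qed.

Lemma udiscE m (x : udisc R m) : sqnorm (set_val x) <= 1.
Proof. exact: set_mem (valP x). Qed.

(** At the origin, where there is no direction, the value is [s0]. *)
Definition normalize m (s0 : usphere R m) (x : 'rV[R]_m) : usphere R m :=
  insubd s0 ((enorm x)^-1 *: x).

Lemma normalizeE m (s0 : usphere R m) (x : 'rV[R]_m) : x != 0 ->
  set_val (normalize s0 x) = (enorm x)^-1 *: x.
Proof.
move=> x0; rewrite /normalize set_valE insubdK //.
apply/mem_set; rewrite /usphere /= sqnormZ -sqr_enorm exprVn mulVf //.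
by rewrite expf_neq0 // gt_eqF // enorm_gt0.
Qed.

Lemma usphere_inj m (x y : usphere R m) : set_val x = set_val y -> x = y.
Proof. exact: val_inj. Qed.

Lemma udisc_inj m (x y : udisc R m) : set_val x = set_val y -> x = y.
Proof. exact: val_inj. Qed.

Lemma normalize_id m (s0 s : usphere R m) : normalize s0 (set_val s) = s.
Proof.
apply: usphere_inj; rewrite normalizeE.
  by rewrite /enorm usphereE sqrtr1 invr1 scale1r.
by rewrite -sqnorm_eq0 usphereE oner_eq0.
Qed.

Lemma at_normalize (T : topologicalType) m s0 (f : T -> 'rV[R]_m) (x : T) :
  f x != 0 -> {for x, continuous f} ->
  {for x, continuous (fun z => normalize s0 (f z))}.
Proof.
move=> f0 cf; apply: at_set_type.
have e0 : enorm (f x) != 0 by rewrite gt_eqF // enorm_gt0.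
have : {for x, continuous (fun z => (enorm (f z))^-1 *: f z)}.
  by apply: at_scale => //; apply: at_inv => //; exact: at_enorm.
apply: at_eq_near.
have := @at_lt R _ (fun=> 0) (fun z => enorm (f z)) x (@at_cst _ _ 0 x) (at_enorm cf).
rewrite enorm_gt0 => /(_ f0); apply: filterS => z; rewrite enorm_gt0 => fz0.
by rewrite normalizeE.
Qed.

Fact zero_in_udisc m : (0 : 'rV[R]_m) \in udisc R m.
Proof. by apply/mem_set; rewrite /udisc /= sqnorm0 ler01. Qed.

(** The radial retraction of the whole space onto the disc *)
Definition to_disc m (x : 'rV[R]_m) : udisc R m :=
  insubd (exist _ 0 (zero_in_udisc m)) ((Num.max 1 (enorm x))^-1 *: x).

Lemma to_discE m (x : 'rV[R]_m) :
  set_val (to_disc x) = (Num.max 1 (enorm x))^-1 *: x.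
Proof.
rewrite /to_disc set_valE insubdK //; apply/mem_set; rewrite /udisc /= sqnormZ -sqr_enorm.
have m1 : 1 <= Num.max 1 (enorm x) by rewrite le_max lexx.
rewrite -exprMn expr_le1 // ?mulr_ge0 ?invr_ge0 ?enorm_ge0 //; last first.
  by rewrite (le_trans _ m1).
by rewrite mulrC ler_pdivrMr ?mul1r ?le_max ?lexx ?orbT // (lt_le_trans _ m1).
Qed.

Lemma to_disc_val m (x : 'rV[R]_m) : sqnorm x <= 1 -> set_val (to_disc x) = x.
Proof.
move=> x1; rewrite to_discE max_l ?invr1 ?scale1r //.
by rewrite -(@expr_le1 _ 2) ?enorm_ge0 ?sqr_enorm.
Qed.

Lemma to_disc_id m (x : udisc R m) : to_disc (set_val x) = x.
Proof. by apply: udisc_inj; rewrite to_disc_val // udiscE. Qed.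

Lemma at_to_disc (T : topologicalType) m (f : T -> 'rV[R]_m) (x : T) :
  {for x, continuous f} -> {for x, continuous (fun z => to_disc (f z))}.
Proof.
move=> cf; apply: at_set_type.
apply: (@at_eq _ _ (fun z => (Num.max 1 (enorm (f z)))^-1 *: f z)) => [z|].
  by rewrite to_discE.
apply: at_scale => //; apply: at_inv.
  by rewrite gt_eqF // lt_max ltr01.
by apply: at_max; [exact: at_cst|exact: at_enorm].
Qed.

End Euclid.

Section CompactHausdorff.
Variable R : realType.

Lemma compact_set_type (T : topologicalType) (A : set T) :
  compact A -> compact [set: A].
Proof.
move=> /compact_near_coveringP/near_covering_withinP cA.
apply/compact_near_coveringP => I F P FF cP.
pose P' (i : I) (y : T) := forall x : A, set_val x = y -> P i x.
have : \near F, A `<=` P' F.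
  apply: cA => y Ay; have [[/= B G] [nB nG] BG] := cP (exist _ y (mem_set Ay)) Logic.I.
  case: nB => /= _ [[W oW <-] Wy] WB.
  exists (W, G); first by split=> //=; rewrite nbhsE; exists W.
  by move=> [y' i] /= [Wy' Gi] _ x xy; apply: (BG (x, i)); split=> //=;
    apply: WB; rewrite /= xy.
by apply: filterS => i PA x _; apply: (PA (set_val x)) => //; exact: set_mem (valP x).
Qed.

Lemma inj_hausdorff (T U : topologicalType) (f : T -> U) :
  continuous f -> injective f -> hausdorff_space U -> hausdorff_space T.
Proof.
move=> cf fI hU x y xy; apply: fI; apply: hU => A B nA nB.
by have [z [Az Bz]] := xy _ _ (cf _ _ nA) (cf _ _ nB); exists (f z).
Qed.

Lemma hausdorff_set_type (T : topologicalType) (A : set T) :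
  hausdorff_space T -> hausdorff_space A.
Proof. apply: inj_hausdorff; [exact: initial_continuous|exact: val_inj]. Qed.

Lemma hausdorff_prod (T U : topologicalType) :
  hausdorff_space T -> hausdorff_space U -> hausdorff_space (T * U)%type.
Proof.
move=> hT hU [a b] [c d] abcd; congr pair.
- apply: hT => A B nA nB.
  have [|| [x y] [/= ? ?]] := abcd (fst @^-1` A) (fst @^-1` B).
  + by apply: cvg_fst.
  + by apply: cvg_fst.
  + by exists x.
- apply: hU => A B nA nB.
  have [|| [x y] [/= ? ?]] := abcd (snd @^-1` A) (snd @^-1` B).
  + by apply: cvg_snd.
  + by apply: cvg_snd.
  + by exists y.
Qed.

Lemma closed_pt (T : topologicalType) (x : T) : hausdorff_space T -> closed [set x].
Proof. by move=> hT; apply: compact_closed => //; exact: compact_set1. Qed.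

Variable m : nat.

Lemma udisc_compact : compact (udisc R m).
Proof.
apply: bounded_closed_compact.
  exists 1; split; first exact: num_real.
  move=> M M1 x; rewrite /udisc /= => x1.
  rewrite [leLHS]/Num.Def.normr /= mx_normrE; apply: bigmax_le => [|[i j] _ /=]; first lra.
  apply: le_trans (ltW M1); rewrite (ord1 i) -(@expr_le1 _ 2) ?normr_ge0 //.
  rewrite real_normK ?num_real //; apply: le_trans x1.
  by rewrite /sqnorm (bigD1 j) //= lerDl sumr_ge0 // => k _; exact: sqr_ge0.
have -> : udisc R m = @sqnorm R m @^-1` [set t : R | t <= 1] by [].
apply: closed_comp; last exact: closed_le.
by move=> x _; apply: at_sqnorm; exact: at_id.
Qed.

Lemma usphere_compact : compact (usphere R m).
Proof.
apply: subclosed_compact udisc_compact _; last first.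
  by move=> x; rewrite /usphere /udisc /= => ->.
have -> : usphere R m = @sqnorm R m @^-1` [set 1] by [].
apply: closed_comp; last exact: closed_eq.
by move=> x _; apply: at_sqnorm; exact: at_id.
Qed.

Lemma rV_hausdorff : hausdorff_space 'rV[R]_m.
Proof. exact: norm_hausdorff. Qed.

End CompactHausdorff.

(** * Polar coordinates on a disc, with an arbitrary interior centre *)

Section Clamp.
Variable R : realType.

Definition clamp (r : R) : R := Num.max 0 (Num.min 1 r).

Lemma clamp_itv r : 0 <= clamp r <= 1.
Proof. by rewrite /clamp le_max lexx ge_max ler01 ge_min lexx. Qed.

Lemma clamp_id r : 0 <= r <= 1 -> clamp r = r.
Proof. by move=> /andP[r0 r1]; rewrite /clamp min_r // max_r. Qed.

Lemma clamp_le0 r : r <= 0 -> clamp r = 0.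
Proof. by move=> r0; rewrite /clamp min_r ?max_l // (le_trans r0). Qed.

Lemma clamp_ge1 r : 1 <= r -> clamp r = 1.
Proof. by move=> r0; rewrite /clamp min_l ?max_r. Qed.

Lemma clampK r : clamp (clamp r) = clamp r.
Proof. exact: clamp_id (clamp_itv r). Qed.

Lemma at_clamp (T : topologicalType) (f : T -> R) (x : T) :
  {for x, continuous f} -> {for x, continuous (fun z => clamp (f z))}.
Proof. by move=> cf; rewrite /clamp; cts. Qed.

End Clamp.

Section Polar.
Variables (R : realType) (m : nat) (v : udisc R m).

Definition polar_vec (p : usphere R m * R) : 'rV[R]_m :=
  (1 - clamp p.2) *: set_val v + clamp p.2 *: set_val p.1.

Definition polar (p : usphere R m * R) : udisc R m := to_disc (polar_vec p).

Lemma polarE p : set_val (polar p) = polar_vec p.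
Proof.
rewrite /polar to_disc_val //; apply: sqnorm_convex; first exact: clamp_itv.
  exact: udiscE.
by rewrite usphereE.
Qed.

Lemma polar_continuous : continuous polar.
Proof.
move=> p; apply: at_to_disc; rewrite /polar_vec.
have c : {for p, continuous (fun p : usphere R m * R => clamp p.2)}.
  by apply: at_clamp; cts.
by cts.
Qed.

Lemma polar_clamp s r : polar (s, clamp r) = polar (s, r).
Proof. by rewrite /polar /polar_vec /= clampK. Qed.

Lemma polar1 s : polar (s, 1) = sphere_incl s.
Proof.
apply: udisc_inj; rewrite polarE /polar_vec /= clamp_ge1 // subrr scale0r add0r.
by rewrite scale1r.
Qed.

Lemma polar0 s : polar (s, 0) = v.
Proof.
apply: udisc_inj; rewrite polarE /polar_vec /= clamp_le0 // subr0 scale1r.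
by rewrite scale0r addr0.
Qed.

Hypothesis v_int : sqnorm (set_val v) < 1.

Lemma polar_inj s s' (r r' : R) : 0 <= r <= 1 -> 0 <= r' <= 1 ->
  polar (s, r) = polar (s', r') -> r = r' /\ (r = 0 \/ s = s').
Proof.
move=> r01 r01' /(congr1 set_val); rewrite !polarE /polar_vec /= !clamp_id // => E.
have {}E : r *: set_val s - r' *: set_val s' = (r - r') *: set_val v.
  apply/eqP; rewrite subr_eq -(inj_eq (addrI ((1 - r) *: set_val v))) E addrA.
  by rewrite -scalerDl (_ : 1 - r + (r - r') = 1 - r') //; ring.
move: r01 r01' => /andP[r0 r1] /andP[r0' r1'].
have rr' : r = r'.
  have /(congr1 (@sqnorm R m)) := E.
  rewrite sqnormB !sqnormZ dotZl dotZr !usphereE => E2.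
  have := dot_le (set_val s) (set_val s'); rewrite !usphereE => D.
  have : (r - r') ^+ 2 * (1 - sqnorm (set_val v)) <= 0.
    have : 0 <= r * r' * (2 - 2 * dot (set_val s) (set_val s')).
      by rewrite mulr_ge0 ?mulr_ge0 //; lra.
    by move: E2; lra.
  rewrite pmulr_lle0 ?subr_gt0 // => h; apply/eqP; rewrite -subr_eq0 -sqrf_eq0.
  by rewrite eq_le h sqr_ge0.
split=> //; case: (eqVneq r 0) => [->|rn0]; [by left|right].
apply: usphere_inj; move: E; rewrite -rr' subrr scale0r -scalerBr => /eqP.
by rewrite scaler_eq0 (negbTE rn0) /= subr_eq0 => /eqP.
Qed.

Lemma polar_eq_centre s r : 0 <= r <= 1 -> polar (s, r) = v -> r = 0.
Proof.
move=> r01 E; have [] // := @polar_inj s s r 0 r01.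
  by rewrite lexx ler01.
by rewrite polar0.
Qed.

(** The ray from the centre through [d] is found by the intermediate value
theorem: [r] solves [|d - (1 - r) v| = r]. *)
Lemma polar_surj (s0 : usphere R m) (d : udisc R m) :
  exists2 p, 0 <= p.2 <= 1 & polar p = d.
Proof.
pose w (r : R) := set_val d - (1 - r) *: set_val v.
pose phi (r : R) := sqnorm (w r) - r ^+ 2.
have cphi : continuous phi.
  move=> r; have cw : {for r, continuous (fun r => sqnorm (w r))}.
    by apply: at_sqnorm; rewrite /w; cts.
  apply: (@at_eq _ _ (fun r => sqnorm (w r) - r * r)) => [z|]; first by [].
  by cts.
have [r r01 phir] : exists2 r, r \in `[0, 1] & phi r = 0.
  apply: IVT; rewrite ?ler01 //.
    exact: continuous_subspaceT.
  have phi0 : 0 <= phi 0 by rewrite /phi expr0n /= subr0 sqnorm_ge0.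
  have phi1 : phi 1 <= 0.
    by rewrite /phi /w subrr scale0r subr0 expr1n subr_le0 udiscE.
  have phi10 := le_trans phi1 phi0.
  by rewrite min_r // max_l // phi0 phi1.
have {}r01 : 0 <= r <= 1 by move: r01; rewrite in_itv.
have wr : sqnorm (w r) = r ^+ 2 by move/eqP: phir; rewrite subr_eq0 => /eqP.
have en : enorm (w r) = r.
  by rewrite /enorm wr sqrtr_sqr ger0_norm //; case/andP: r01.
exists (normalize s0 (w r), r) => //; apply: udisc_inj.
rewrite polarE /polar_vec /= clamp_id //.
have [w0|w0] := eqVneq (w r) 0.
  have r0 : r = 0 by rewrite -en w0 /enorm sqnorm0 sqrtr0.
  rewrite r0 scale0r addr0 subr0 scale1r.
  by move/eqP: w0; rewrite /w r0 subr0 scale1r subr_eq0 => /eqP.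
rewrite normalizeE // en scalerA mulfV.
  by rewrite scale1r /w addrCA subrr addr0.
by rewrite -en gt_eqF // enorm_gt0.
Qed.

Lemma polar_box_compact : compact ([set: usphere R m] `*` `[0, 1 : R]%classic).
Proof.
apply: compact_setX; last exact: segment_compact.
by apply: compact_set_type; exact: usphere_compact.
Qed.

Variable s0 : usphere R m.

Lemma polar_identification : identification polar.
Proof.
apply: (compact_identification _ polar_continuous polar_box_compact).
  by apply: hausdorff_set_type; exact: rV_hausdorff.
by move=> d; have [p p01 pd] := polar_surj s0 d; exists p.
Qed.

Definition polar_coord (d : udisc R m) : usphere R m * R :=
  projT1 (cid2 (polar_surj s0 d)).

Lemma polar_coord_itv d : 0 <= (polar_coord d).2 <= 1.
Proof. by rewrite /polar_coord; case: cid2. Qed.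

Lemma polar_coordK d : polar (polar_coord d) = d.
Proof. by rewrite /polar_coord; case: cid2. Qed.

Definition polar_lift (Y : Type) (c : usphere R m * R -> Y) (d : udisc R m) : Y :=
  c (polar_coord d).

Lemma polar_liftE (Y : Type) (c : usphere R m * R -> Y) s r :
  (forall s s', c (s, 0) = c (s', 0)) ->
  polar_lift c (polar (s, r)) = c (s, clamp r).
Proof.
move=> c0; rewrite -polar_clamp /polar_lift.
have := polar_coord_itv (polar (s, clamp r)).
have := polar_coordK (polar (s, clamp r)).
case: (polar_coord _) => s' r' /= E r01.
have [<- [->|->]] := polar_inj r01 (clamp_itv r) E => //.
Qed.

End Polar.

(** * Attaching a cell *)

Section AttachCell.
Variables (R : realType) (m : nat) (v : udisc R m).
Hypothesis v_int : sqnorm (set_val v) < 1.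
Variable s0 : usphere R m.
Local Notation B := (usphere R m).

Local Notation "'inZ' al" := (pushout_inl al (@sphere_incl R m)) (at level 10).
Local Notation "'inD' al" := (pushout_inr al (@sphere_incl R m)) (at level 10).

Section Rec.
Variables (Z : topologicalType) (al : B -> Z).

Lemma cell_glue s : inZ al (al s) = inD al (polar v (s, 1)).
Proof. by rewrite pushout_glue polar1. Qed.

Definition cell_rec (Y : Type) (h : Z -> Y) (c : B * R -> Y) :
  attach_cell al -> Y := pushout_rec h (polar_lift v s0 c).

Section RecE.
Variables (Y : Type) (h : Z -> Y) (c : B * R -> Y).
Hypotheses (hc : forall s, h (al s) = c (s, 1))
           (c0 : forall s s', c (s, 0) = c (s', 0)).

Let compat s : h (al s) = polar_lift v s0 c (sphere_incl s).
Proof. by rewrite -(polar1 v) polar_liftE // clamp_ge1. Qed.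

Lemma cell_rec_inl z : cell_rec h c (inZ al z) = h z.
Proof. exact: pushout_rec_inl. Qed.

Lemma cell_rec_inr s r : cell_rec h c (inD al (polar v (s, r))) = c (s, clamp r).
Proof. by rewrite /cell_rec pushout_rec_inr // polar_liftE. Qed.

End RecE.

Lemma cell_ind (P : attach_cell al -> Prop) :
  (forall z, P (inZ al z)) ->
  (forall s r, 0 <= r <= 1 -> P (inD al (polar v (s, r)))) -> forall w, P w.
Proof.
move=> Pl Pr; apply: pushout_ind => // d.
by have [[s r] r01 <-] := polar_surj v s0 d; exact: Pr.
Qed.

(** The base and the cell in polar coordinates together form an identification
onto the attaching space, which stays one after taking the product with the
line; so homotopies are built from a base part [h] and a polar part [c]. *)
Lemma cell_rec_continuous (Y : topologicalType) (h : Z * R -> Y)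
    (c : (B * R) * R -> Y) :
  continuous h -> continuous c ->
  (forall s t, h (al s, t) = c ((s, 1), t)) ->
  (forall s s' t, c ((s, 0), t) = c ((s', 0), t)) ->
  continuous (fun p : attach_cell al * R =>
    cell_rec (fun z => h (z, p.2)) (fun q => c (q, p.2)) p.1).
Proof.
move=> ch cc hc c0 [w t].
have iq := pushout_cover_identification al (@sphere_incl R m)
  (polar_identification v s0).
apply: (@identification_homotopy R _ _ _ _ setT _ iq) => //.
  exact: openT.
move=> [z|[s r]] {}t _.
- apply: at_inl; apply: (@at_eq _ _ h) => [[z' t']|]; last exact: ch.
  by rewrite /= cell_rec_inl.
- apply: at_inr.
  apply: (@at_eq _ _ (fun p : (B * R) * R => c ((p.1.1, clamp p.1.2), p.2))).
    by move=> [[s' r'] t']; rewrite /= cell_rec_inr.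
  have ? : {for (s, r, t), continuous (fun p : (B * R) * R => clamp p.1.2)}.
    by apply: at_clamp; cts.
  by cts.
Qed.

Lemma cell_rec_continuous1 (Y : topologicalType) (h : Z -> Y) (c : B * R -> Y) :
  continuous h -> continuous c -> (forall s, h (al s) = c (s, 1)) ->
  (forall s s', c (s, 0) = c (s', 0)) -> continuous (cell_rec h c).
Proof.
move=> ch cc hc c0 w.
have H : continuous (fun p : attach_cell al * R => cell_rec h c p.1).
  by apply: (@cell_rec_continuous Y (fun p => h p.1) (fun p => c p.1)) =>
    [p|p|s t|s s' t] /=; [cts|cts|exact: hc|exact: c0].
apply: (@at_comp _ _ _ (fun w => (w, 0 : R)) (fun p => cell_rec h c p.1)).
  by cts.
exact: H.
Qed.

End Rec.

Section Shift.
Variable Z : topologicalType.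

(** The cell of [attach_cell al] continued, beyond its boundary, by the track
of a homotopy [b] that starts at [al] *)
Definition long_ray (al : B -> Z) (b : B * R -> Z) (p : B * R) : attach_cell al :=
  if p.2 <= 1 then inD al (polar v p) else inZ al (b (p.1, p.2 - 1)).

Lemma long_ray_continuous al b : continuous b -> (forall s, b (s, 0) = al s) ->
  continuous (long_ray al b).
Proof.
move=> cb b0 p; have cl := @pushout_inl_continuous _ _ _ al (@sphere_incl R m).
have cr := @pushout_inr_continuous _ _ _ al (@sphere_incl R m).
have cp := @polar_continuous R m v.
apply: (@at_if R _ _ snd (fun=> 1)) => [||_|_|E]; try by cts.
by case: p E => s r /= ->; rewrite subrr b0 -cell_glue.
Qed.

(** The inner half of the cell covers the cell, and the outer half follows the track
of the homotopy to the old attaching map. *)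
Definition cell_shift (al al' : B -> Z) (b : B * R -> Z) :
    attach_cell al -> attach_cell al' :=
  cell_rec (inZ al') (fun p => long_ray al' b (p.1, 2 * p.2)).

Arguments cell_shift : clear implicits.

Section OneShift.
Variables (al al' : B -> Z) (b : B * R -> Z).
Hypotheses (cb : continuous b) (b0 : forall s, b (s, 0) = al' s)
  (b1 : forall s, b (s, 1) = al s).

Let compat1 s : inZ al' (al s) = long_ray al' b (s, 2 * 1).
Proof.
rewrite /long_ray /= ifF; last by apply/negbTE; rewrite -ltNge; lra.
by rewrite (_ : 2 * 1 - 1 = 1) ?b1 //; lra.
Qed.

Let compat0 s s' : long_ray al' b (s, 2 * 0) = long_ray al' b (s', 2 * 0).
Proof. by rewrite /long_ray /= mulr0 ler01 !polar0. Qed.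

Lemma cell_shift_continuous : continuous (cell_shift al al' b).
Proof.
apply: cell_rec_continuous1 => //; first exact: pushout_inl_continuous.
have := long_ray_continuous cb b0 => cl p.
by cts.
Qed.

Lemma cell_shift_inl z : cell_shift al al' b (inZ al z) = inZ al' z.
Proof. exact: cell_rec_inl. Qed.

Lemma cell_shift_inr s r : cell_shift al al' b (inD al (polar v (s, r))) =
  long_ray al' b (s, 2 * clamp r).
Proof. exact: cell_rec_inr. Qed.

End OneShift.

(** Shifting forth and back follows the ray, then the track, then the track
backwards: on a long ray this is the reparametrization by [min (4 r) (3 - 2 r)],
which is linearly homotopic to the identity. *)
Lemma cell_shiftK (al al' : B -> Z) (b b' : B * R -> Z) :
  continuous b' ->
  (forall s t, b' (s, t) = b (s, 1 - t)) ->
  (forall s, b (s, 0) = al' s) -> (forall s, b (s, 1) = al s) ->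
  line_homotopic R (cell_shift al' al b' \o cell_shift al al' b) id.
Proof.
move=> cb' bb' b0 b1.
have b0' s : b' (s, 0) = al s by rewrite bb' subr0.
have b1' s : b' (s, 1) = al' s by rewrite bb' subrr.
pose c (p : (B * R) * R) := long_ray al b'
  (p.1.1, (1 - p.2) * Num.min (4 * p.1.2) (3 - 2 * p.1.2) + p.2 * p.1.2).
have c1 s t : c ((s, 1), t) = inZ al (al s).
  rewrite /c /= min_r; last lra.
  rewrite (_ : _ + _ = 1); last ring.
  by rewrite /long_ray /= lexx cell_glue.
have c0 s s' t : c ((s, 0), t) = c ((s', 0), t).
  rewrite /c /= min_l; last lra.
  by rewrite !mulr0 addr0 /long_ray /= ler01 !polar0.
exists (fun p => cell_rec (inZ al) (fun q => c (q, p.2)) p.1); split.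
- apply: (@cell_rec_continuous _ _ _ (fun p => inZ al p.1) c) => // p.
    have := @pushout_inl_continuous _ _ _ al (@sphere_incl R m) => cl.
    by cts.
  have cl := long_ray_continuous cb' b0'.
  by rewrite /c; cts.
- apply: cell_ind => [z|s r r01]; rewrite /comp.
    by rewrite !cell_shift_inl // cell_rec_inl.
  rewrite cell_shift_inr // cell_rec_inr // clamp_id //.
  move: r01 => /andP[r0 r1].
  rewrite /c /= subr0 mul1r mul0r addr0 {2}/long_ray /=.
  case: (lerP (2 * r) 1) => r2.
    rewrite cell_shift_inr // clamp_id ?mulr_ge0 // min_l; last lra.
    by congr (long_ray _ _ (_, _)); ring.
  rewrite cell_shift_inl // min_r; last lra.
  rewrite /long_ray /=; case: (lerP (3 - 2 * r) 1) => r3.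
    have -> : r = 1 by lra.
    have -> : 2 * 1 - 1 = 1 :> R by ring.
    have -> : 3 - 2 * 1 = 1 :> R by ring.
    by rewrite b1 cell_glue.
  by rewrite bb'; congr (inZ al (b (_, _))); ring.
- apply: cell_ind => [z|s r r01]; first by rewrite cell_rec_inl.
  rewrite cell_rec_inr // clamp_id // /c /= subrr mul0r mul1r add0r /long_ray /=.
  by case/andP: r01 => _ ->.
Qed.

(** The two shifts, along a homotopy and along its reverse, are mutually inverse up
to homotopy. *)
Lemma attach_cell_homotopic (al al' : B -> Z) :
  line_homotopic R al al' ->
  line_equivalent R (attach_cell al) (attach_cell al').
Proof.
move=> [b [cb b0 b1]]; pose b' p := b (p.1, 1 - p.2).
have cb' : continuous b' by move=> p; rewrite /b'; cts.
have b0' s : b' (s, 0) = al' s by rewrite /b' subr0.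
have b1' s : b' (s, 1) = al s by rewrite /b' subrr.
exists (cell_shift al al' b'), (cell_shift al' al b); split.
- exact: cell_shift_continuous.
- exact: cell_shift_continuous.
- apply: cell_shiftK => // s t.
  by rewrite /b' /= opprB addrCA subrr addr0.
- exact: cell_shiftK.
Qed.

End Shift.

(** * Collapsing a cell attached along a fibre *)

Section HalfSmash.
Variables (X : topologicalType) (x0 : X).

(** A deformation of [X * 0] within [X * 0 \cup x0 * I] that moves [x0] along its
own interval and up to its top. It carries the part of the homotopy extension
property of [x0] that is used below, in a form that is inherited when cells are
added: how fast [x0] climbs is left free. *)
Definition nondegenerate_point : Prop := exists r : X * R -> X * R,
  [/\ continuous r,
      forall x, r (x, 0) = (x, 0),
      forall t, (r (x0, t)).1 = x0 /\ (r (x0, 1)).2 = 1 &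
      forall x t, 0 <= (r (x, t)).2 /\ ((r (x, t)).2 = 0 \/ (r (x, t)).1 = x0)].

Definition fibre_incl (s : B) : X * B := (x0, s).

Local Notation hs := (quot_proj (@half_smash_rel X x0 B)).
Local Notation inX := (inZ fibre_incl).
Local Notation inC := (inD fibre_incl).

(** The interval over [x0] leads, for each [s], from the boundary point [s] of the
attached cell to its centre. *)
Definition climb (s : B) (q : X * R) : attach_cell fibre_incl :=
  if q.2 <= 0 then inX (q.1, s) else inC (polar v (s, 1 - q.2)).

Hypothesis hX : hausdorff_space X.

(** The two branches agree at level [0] over [x0]; elsewhere the level vanishes
identically nearby. *)
Lemma climb_continuous (r : X * R -> X * R) : continuous r ->
  (forall x t, 0 <= (r (x, t)).2 /\ ((r (x, t)).2 = 0 \/ (r (x, t)).1 = x0)) ->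
  continuous (fun p : (X * B) * R => climb p.1.2 (r (p.1.1, p.2))).
Proof.
move=> cr rP p.
have cl := @pushout_inl_continuous _ _ _ fibre_incl (@sphere_incl R m).
have cd := @pushout_inr_continuous _ _ _ fibre_incl (@sphere_incl R m).
have cp := @polar_continuous R m v.
pose q (p : (X * B) * R) := r (p.1.1, p.2).
have cq : continuous q by move=> p'; rewrite /q; cts.
have c1 : {for p, continuous (fun p => inX ((q p).1, p.1.2))} by cts.
case: (pselect ((q p).1 = x0)) => qp.
  apply: (@at_if R _ _ (fun p => (q p).2) (fun=> 0)) => [||_|_|E]; try by cts.
  by rewrite -/(q p) qp E subr0 -cell_glue.
apply: at_eq_near c1.
have : nbhs (q p).1 (~` [set x0]).
  by apply: open_nbhs_nbhs; split=> //; apply: closed_openC; exact: closed_pt.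
have cq1 : {for p, continuous (fun p => (q p).1)} by cts.
move=> /cq1; apply: (@filterS _ (nbhs p)) => p' /= qp'.
have [_ [q0|//]] := rP p'.1.1 p'.2.
by rewrite /climb q0 lexx.
Qed.

(** The homotopy inverse of the collapse sends [(x, s)] to the end of the climb of
[x], which at [x0] is the centre of the cell for every [s]. *)
Lemma attach_fibre_half_smash :
  nondegenerate_point -> line_equivalent R (attach_cell fibre_incl) (half_smash x0 B).
Proof.
move=> [r [cr r0 rx rP]].
have cl := @pushout_inl_continuous _ _ _ fibre_incl (@sphere_incl R m).
have cd := @pushout_inr_continuous _ _ _ fibre_incl (@sphere_incl R m).
have cp := @polar_continuous R m v.
have ch := identification_continuous (quot_proj_identification (@half_smash_rel X x0 B)).
have hsE s s' : hs (x0, s) = hs (x0, s') by exact: quot_proj_eq.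
have r1 : r (x0, 1) = (x0, 1) by have [] := rx 1; case: (r _) => a b /= -> ->.
have cK := climb_continuous cr rP.
pose Phi : attach_cell fibre_incl -> half_smash x0 B :=
  cell_rec (fun q => hs q) (fun _ => hs (x0, s0)).
have PhiX q : Phi (inX q) = hs q by rewrite /Phi cell_rec_inl // => s; exact: hsE.
have PhiC d s : Phi (inC d) = hs (x0, s).
  have [[s' r'] _ <-] := polar_surj v s0 d.
  by rewrite /Phi cell_rec_inr // => *; exact: hsE.
pose psi (q : X * B) := climb q.2 (r (q.1, 1)).
pose Psi : half_smash x0 B -> attach_cell fibre_incl := quot_lift psi.
have psix s : psi (x0, s) = inC v.
  by rewrite /psi /= r1 /climb /= ifF ?subrr ?polar0 //; apply/negbTE; rewrite -ltNge ltr01.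
have PsiE q : Psi (hs q) = psi q.
  by apply: quot_liftE => -[x s] [x' s'] [/= -> ->]; rewrite !psix.
exists Phi, Psi; split.
- apply: cell_rec_continuous1 => // p; exact: at_cst.
- move=> w; apply: (@identification_at R _ _ _ _ setT _
    (quot_proj_identification _)) => //; first exact: openT.
  move=> q _; apply: (@at_eq _ _ psi) => [q'|]; first by rewrite PsiE.
  apply: (@at_comp _ _ _ (fun q : X * B => (q, 1 : R))
    (fun p => climb p.1.2 (r (p.1.1, p.2))) q); first by cts.
  exact: cK.
- apply: line_homotopic_sym.
  pose h (p : (X * B) * R) := climb p.1.2 (r (p.1.1, p.2)).
  pose c (p : (B * R) * R) := inC (polar v (p.1.1, (1 - (r (x0, p.2)).2) * p.1.2)).
  have hc s t : h (fibre_incl s, t) = c ((s, 1), t).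
    rewrite /h /c /climb /= mulr1; have [-> _] := rx t; have [u0 _] := rP x0 t.
    case: lerP => // u1; have -> : (r (x0, t)).2 = 0 by apply/eqP; rewrite eq_le u1.
    by rewrite subr0 -cell_glue.
  have c0 s s' t : c ((s, 0), t) = c ((s', 0), t) by rewrite /c /= mulr0 !polar0.
  exists (fun p => cell_rec (fun z => h (z, p.2)) (fun q => c (q, p.2)) p.1); split.
  + apply: cell_rec_continuous => //.
    by move=> p; rewrite /c; cts.
  + apply: cell_ind => [[x s]|s t t01].
      by rewrite cell_rec_inl // /h /= r0 /climb /= lexx.
    by rewrite cell_rec_inr // clamp_id // /c /= r0 /= subr0 mul1r.
  + apply: cell_ind => [[x s]|s t t01]; rewrite /comp.
      by rewrite cell_rec_inl // PhiX PsiE.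
    rewrite cell_rec_inr // (PhiC _ s0) PsiE psix /c /= r1 /= subrr mul0r.
    by rewrite polar0.
- apply: line_homotopic_sym.
  pose k (t : R) (q : X * B) := hs ((r (q.1, t)).1, q.2).
  have kE t q : quot_lift (k t) (hs q) = k t q.
    apply: quot_liftE => -[x s] [x' s'] [/= -> ->]; rewrite /k /=.
    by have [-> _] := rx t.
  exists (fun p => quot_lift (k p.2) p.1); split.
  + move=> [w t]; apply: (@identification_homotopy R _ _ _ _ setT _
      (quot_proj_identification _)) => //; first exact: openT.
    move=> q {}t _; apply: (@at_eq _ _ (fun p => k p.2 p.1)) => [p|]; first by rewrite kE.
    by rewrite /k; cts.
  + move=> w; have [[x s] <-] := (quot_proj_identification (@half_smash_rel X x0 B)).1 w.
    by rewrite kE /k /= r0.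
  + move=> w; have [[x s] <-] := (quot_proj_identification (@half_smash_rel X x0 B)).1 w.
    rewrite kE /comp PsiE /k /psi /climb /=.
    have [u0 u] := rP x 1; case: lerP => u1; first by rewrite PhiX.
    rewrite (PhiC _ s); case: u => [E|-> //].
    by rewrite E ltxx in u1.
Qed.

End HalfSmash.

End AttachCell.

(** * Points of a finite CW complex are nondegenerate *)

Section EuclidMore.
Variables (R : realType) (m : nat).

Lemma enormZ (a : R) (x : 'rV[R]_m) : enorm (a *: x) = `|a| * enorm x.
Proof. by rewrite /enorm sqnormZ sqrtrM ?sqr_ge0 // sqrtr_sqr. Qed.

Lemma enorm_le1 (x : 'rV[R]_m) : (enorm x <= 1) = (sqnorm x <= 1).
Proof. by rewrite -sqr_enorm expr_le1 // enorm_ge0. Qed.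

Lemma to_disc_sphere (x : 'rV[R]_m) : 1 <= enorm x ->
  sqnorm (set_val (to_disc x)) = 1.
Proof.
move=> x1; rewrite to_discE max_r // sqnormZ -sqr_enorm -exprMn mulVf ?expr1n //.
by rewrite gt_eqF // (lt_le_trans _ x1).
Qed.

Lemma to_discZ (a : R) (x : 'rV[R]_m) : 0 < a -> 1 <= a * enorm x ->
  set_val (to_disc (a *: x)) = (enorm x)^-1 *: x.
Proof.
move=> a0 ax; rewrite to_discE enormZ gtr0_norm // max_r // scalerA invfM.
by rewrite mulrAC mulVf ?mul1r // gt_eqF.
Qed.

End EuclidMore.

Section CWNondegenerate.
Variables (R : realType) (X : topologicalType) (C : finite_CW R X).
Local Notation cell := (cw_cell C).
Local Notation dim := (@cw_cell_dim R X C).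
Local Notation chi e := (@cw_char R X C e).
Local Notation I01 := `[0, 1 : R]%classic.

Lemma I01P (t : R) : I01 t = (0 <= t <= 1).
Proof. by rewrite /= in_itv. Qed.

Definition cellset (S : {set cell}) : set X :=
  [set p | exists2 e, e \in S & exists z, chi e z = p].

Definition down_closed (S : {set cell}) : Prop :=
  forall e e', e \in S -> (dim e' < dim e)%N -> e' \in S.

Lemma chi_boundary (S : {set cell}) e (z : udisc R (dim e)) :
  (forall e', (dim e' < dim e)%N -> e' \in S) ->
  sqnorm (set_val z) = 1 -> cellset S (chi e z).
Proof.
move=> lowS /cw_boundary[e' /lowS e'S [z' _ zz']].
by exists e' => //; exists z'.
Qed.

Lemma cellset_open_cell (S : {set cell}) p : down_closed S -> cellset S p ->
  exists2 e, e \in S & open_cell (chi e) p.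
Proof.
move=> dS [e eS [z <-]]; have := udiscE z; rewrite le_eqVlt => /orP[/eqP z1|z1].
  by have [e' e'e oe'] := cw_boundary z1; exists e' => //; exact: dS e'e.
by exists e => //; exists z.
Qed.

Lemma cellset_compact (S : {set cell}) : compact (cellset S).
Proof.
have -> : cellset S = \big[setU/set0]_(e in S) range (chi e).
  rewrite -bigcup_seq_cond; apply/seteqP; split.
    by move=> p [e eS [z <-]]; exists e; [rewrite /= mem_index_enum|exists z].
  by move=> p [e /andP[_ eS] [z _ <-]]; exists e => //; exists z.
apply: bigsetU_compact => e _; apply: continuous_compact.
  by apply: continuous_subspaceT; exact: cw_char_continuous.
by apply: compact_set_type; exact: udisc_compact.
Qed.

Section AddCell.
Variables (S : {set cell}) (e : cell).
Hypotheses (dS : down_closed S) (eS : e \notin S)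
  (lowS : forall e', (dim e' < dim e)%N -> e' \in S).

(** Open cells are disjoint, and a down-closed union of closed cells is the union
of its open cells. *)
Lemma interior_notin_cellset (z : udisc R (dim e)) :
  sqnorm (set_val z) < 1 -> ~ cellset S (chi e z).
Proof.
move=> z1 /(cellset_open_cell dS)[e' e'S oe'].
have oe : open_cell (chi e) (chi e z) by exists z.
by move: e'S; rewrite -(cw_disjoint oe oe') (negbTE eS).
Qed.

(** The smaller subcomplex and the new closed cell are closed and cover the larger
subcomplex, and the new cell carries the quotient topology of the disc. *)
Lemma extend_over_cell (Y : topologicalType) (f : X * R -> Y)
    (G : udisc R (dim e) * R -> Y) :
  {within cellset S `*` I01, continuous f} -> continuous G ->
  (forall z t, sqnorm (set_val z) = 1 -> I01 t -> G (z, t) = f (chi e z, t)) ->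
  exists f' : X * R -> Y,
    [/\ {within cellset (e |: S) `*` I01, continuous f'},
        forall x t, cellset S x -> f' (x, t) = f (x, t) &
        forall z t, I01 t -> f' (chi e z, t) = G (z, t)].
Proof.
move=> cf cG Gf.
pose inv x : udisc R (dim e) := xget (to_disc 0) [set z | chi e z = x].
pose f' p := if `[< cellset S p.1 >] then f p else G (inv p.1, p.2).
have f'S x t : cellset S x -> f' (x, t) = f (x, t).
  by move=> Sx; rewrite /f' /= (asboolT Sx).
have f'e z t : I01 t -> f' (chi e z, t) = G (z, t).
  move=> t01; rewrite /f' /=; case: asboolP => Sz.
    rewrite Gf //; have := udiscE z; rewrite le_eqVlt => /orP[/eqP //|z1].
    by case: (interior_notin_cellset z1).
  have int w : chi e w = chi e z -> sqnorm (set_val w) < 1.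
    move=> wz; have := udiscE w; rewrite le_eqVlt => /orP[/eqP w1|//].
    by case: Sz; rewrite -wz; exact: chi_boundary.
  have iz : chi e (inv (chi e z)) = chi e z.
    exact: (@xgetPex _ (to_disc 0) [set w | chi e w = chi e z] (ex_intro _ z erefl)).
  by rewrite (cw_char_inj (int _ iz) (int _ erefl) iz).
exists f'; split=> //.
pose q (p : udisc R (dim e) * R) := (chi e p.1, p.2).
have cq : continuous q.
  by move=> p; rewrite /q; have := @cw_char_continuous R X C e => cc; cts.
have hXR : hausdorff_space (X * R)%type.
  by apply: hausdorff_prod; [exact: cw_hausdorff C|exact: Rhausdorff].
have cB : compact ([set: udisc R (dim e)] `*` I01).
  apply: compact_setX; last exact: segment_compact.
  by apply: compact_set_type; exact: udisc_compact.
have -> : cellset (e |: S) `*` I01 =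
    (cellset S `*` I01) `|` (q @` ([set: udisc R (dim e)] `*` I01)).
  apply/seteqP; split=> [[x t] [/= [e' e'S [z zx]] t01]|].
    move: e' e'S z zx => e'; rewrite !inE => /orP[/eqP -> z zx|e'S z zx].
      by right; exists (z, t) => //; rewrite /q /= zx.
    by left; split=> //; exists e' => //; exists z.
  move=> [x t] [[[e' e'S [z zx]] t01]|[[z t'] [_ t01] [<- <-]]].
    by split=> //; exists e'; rewrite ?inE ?e'S ?orbT //; exists z.
  by split=> //; exists e; rewrite ?inE ?eqxx //; exists z.
apply: withinU_continuous.
- apply: compact_closed => //.
  by apply: compact_setX; [exact: cellset_compact|exact: segment_compact].
- apply: compact_closed => //; apply: continuous_compact => //.
  exact: continuous_subspaceT.
- apply: subspace_eq_continuous cf => -[x t]; rewrite inE => -[Sx t01].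
  by rewrite /from_subspace f'S.
- apply: compact_image_within => //; first exact: continuous_subspaceT.
  have : {within [set: udisc R (dim e)] `*` I01, continuous G}.
    exact: continuous_subspaceT.
  apply: subspace_eq_continuous => -[z t]; rewrite inE => -[_ t01].
  by rewrite /from_subspace /= /q /= f'e.
Qed.

End AddCell.

Variable x0 : X.

Definition partial_nondegenerate (A : set X) : Prop := exists r : X * R -> X * R,
  [/\ {within A `*` I01, continuous r},
      forall x, A x -> r (x, 0) = (x, 0),
      forall t, I01 t -> (r (x0, t)).1 = x0 /\ (r (x0, 1)).2 = 1 &
      forall x t, A x -> I01 t ->
        0 <= (r (x, t)).2 /\ ((r (x, t)).2 = 0 \/ (r (x, t)).1 = x0)].

(** The cylinder on the new cell is first pushed radially to its bottom and its
side, both of which stay fixed; points that arrive on the side are then moved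
by the given deformation of the smaller subcomplex. *)
Lemma add_cell_nondegenerate (S : {set cell}) e :
  down_closed S -> e \notin S -> (forall e', (dim e' < dim e)%N -> e' \in S) ->
  cellset S x0 -> partial_nondegenerate (cellset S) ->
  partial_nondegenerate (cellset (e |: S)).
Proof.
move=> dS eS lowS Sx0 [r [cr r0 rx rP]].
(* The bottom is reached where [h <= 0]. Where [h >= 0] the norm is at least [1/2],
so [to_disc (4 *: z)] is [z] divided by its norm. *)
pose h (p : udisc R (dim e) * R) := 2 * enorm (set_val p.1) - 2 + clamp p.2.
pose G p := if h p <= 0
  then (chi e (to_disc ((1 - clamp p.2 / 2)^-1 *: set_val p.1)), 0)
  else r (chi e (to_disc (4 *: set_val p.1)), clamp (h p)).
have cchi : continuous (chi e) by exact: cw_char_continuous.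
have cG : continuous G.
  move=> p.
  have cc : {for p, continuous (fun p : udisc R (dim e) * R => clamp p.2)}.
    by apply: at_clamp; cts.
  have cv : {for p, continuous (fun p : udisc R (dim e) * R => set_val p.1)}.
    by cts.
  have ch : {for p, continuous h}.
    by rewrite /h; have := at_enorm cv => ce; cts.
  have /andP[t0 t1] := clamp_itv p.2.
  have d0 : 1 - clamp p.2 / 2 != 0 by rewrite gt_eqF //; lra.
  have z1 : 0 <= h p -> 1 < 4 * enorm (set_val p.1) by rewrite /h; lra.
  have bz y : 1 <= 4 * enorm (set_val y : 'rV[R]_(dim e)) ->
      cellset S (chi e (to_disc (4 *: set_val y))).
    move=> y1; apply: chi_boundary => //; apply: to_disc_sphere.
    by rewrite enormZ gtr0_norm.
  apply: (@at_if R) => [||_|hp|hp].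
  - exact: ch.
  - exact: at_cst.
  - apply: at_pair; last exact: at_cst.
    apply: (@at_comp _ _ _ _ (chi e) p); last exact: cchi.
    apply: at_to_disc; apply: at_scale => //; apply: at_inv => //.
    by apply: at_add; [exact: at_cst|apply: at_opp; apply: at_mul => //; exact: at_cst].
  - apply: (at_within cr).
      apply: at_pair; last exact: at_clamp.
      apply: (@at_comp _ _ _ _ (chi e) p); last exact: cchi.
      by apply: at_to_disc; cts.
    have ce := at_enorm cv.
    have c4 : {for p, continuous (fun p : udisc R (dim e) * R =>
      4 * enorm (set_val p.1))} by cts.
    have := at_lt (@at_cst _ _ (1 : R) p) c4 (z1 hp).
    apply: (@filterS _ (nbhs p)) => q q1; split=> /=; first exact/bz/ltW.
    by rewrite in_itv /= clamp_itv.
  - have {}z1 : 1 < 4 * enorm (set_val p.1) by apply: z1; rewrite hp.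
    have en : enorm (set_val p.1) = 1 - clamp p.2 / 2 by move: hp; rewrite /h; lra.
    rewrite hp (@clamp_le0 _ 0) // r0; last exact/bz/ltW.
    congr (chi e _, _); apply: udisc_inj.
    rewrite !to_discZ ?invr_gt0 ?en ?mulVf //; try lra.
have Gf z t : sqnorm (set_val z) = 1 -> I01 t -> G (z, t) = r (chi e z, t).
  move=> z1; rewrite I01P => t01.
  have en : enorm (set_val z) = 1 by rewrite /enorm z1 sqrtr1.
  rewrite /G /h /= en clamp_id // mulr1 subrr add0r clamp_id //.
  case: ifP => [t0|_].
    have -> : t = 0 by apply/eqP; rewrite eq_le t0; case/andP: t01.
    rewrite mul0r subr0 invr1 scale1r to_disc_id r0 //.
    exact: chi_boundary.
  congr (r (chi e _, _)); apply: udisc_inj.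
  by rewrite to_discZ ?en ?invr1 ?scale1r //; lra.
have [r' [cr' r'S r'e]] := extend_over_cell dS eS lowS cr cG Gf.
have inS x : cellset (e |: S) x -> cellset S x \/ exists z, chi e z = x.
  move=> [e' e'S [z zx]]; move: e' e'S z zx => e'; rewrite !inE.
  move=> /orP[/eqP -> z zx|e'S z zx]; first by right; exists z.
  by left; exists e' => //; exists z.
exists r'; split=> //.
- move=> x /inS[Sx|[z <-]]; first by rewrite r'S // r0.
  rewrite r'e; last by rewrite I01P lexx ler01.
  rewrite /G /h /= clamp_id ?lexx ?ler01 // addr0 mul0r subr0 invr1 scale1r.
  rewrite to_disc_id ifT //; have := udiscE z; rewrite -enorm_le1; lra.
- by move=> t t01; rewrite !r'S //; exact: rx.
- move=> x t /inS[Sx|[z <-]] t01; first by rewrite r'S //; exact: rP.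
  rewrite r'e // /G; case: (lerP (h (z, t)) 0) => hp /=; first by split; [|left].
  apply: rP; last by rewrite I01P clamp_itv.
  apply: chi_boundary => //; apply: to_disc_sphere.
  rewrite enormZ gtr0_norm //; have /andP[_ t1] := clamp_itv t.
  by move: hp; rewrite /h /=; lra.
Qed.

(** On the cells of dimension below that of the cell containing [x0], and on that
cell, one can contract towards [x0] with a speed that vanishes on the
boundary; a point climbs only after it has reached [x0]. *)
Lemma own_cell_nondegenerate : exists S : {set cell},
  [/\ down_closed S, cellset S x0 & partial_nondegenerate (cellset S)].
Proof.
have [e [c c1 cx0]] := @cw_cover R X C x0.
pose S : {set cell} := finset (fun e' => (dim e' < dim e)%N).
have dS : down_closed S.
  by move=> e1 e2; rewrite !inE => e1e e21; exact: ltn_trans e1e.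
have eS : e \notin S by rewrite inE ltnn.
have lowS e' : (dim e' < dim e)%N -> e' \in S by rewrite inE.
(* The last factor is [1] at the preimage [c] of [x0] and [0] on the boundary; the
factor [2] leaves the second half of the time to climb. *)
pose a (p : udisc R (dim e) * R) :=
  2 * clamp p.2 * ((1 - sqnorm (set_val p.1)) / (1 - sqnorm (set_val c))).
pose k p := clamp (1 - a p).
pose G (p : udisc R (dim e) * R) : X * R := (chi e (to_disc ((1 - k p) *: set_val c + k p *: set_val p.1)),
             Num.max 0 (a p - 1)).
have cchi : continuous (chi e) by exact: cw_char_continuous.
have cG : continuous G.
  move=> p.
  have cc : {for p, continuous (fun p : udisc R (dim e) * R => clamp p.2)}.
    by apply: at_clamp; cts.
  have cs : {for p, continuous (fun p : udisc R (dim e) * R => sqnorm (set_val p.1))}.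
    by apply: at_sqnorm; cts.
  have ca : {for p, continuous a} by rewrite /a; cts.
  have ck : {for p, continuous k} by rewrite /k; apply: at_clamp; cts.
  change {for p, continuous G}; rewrite /G; apply: at_pair; last by cts.
  apply: (@at_comp _ _ _ _ (chi e) p); last exact: cchi.
  by apply: at_to_disc; cts.
have cf : {within cellset S `*` I01, continuous (fun p : X * R => (p.1, 0 : R))}.
  by apply: continuous_subspaceT => p; cts.
have k1 z t : a (z, t) = 0 -> G (z, t) = (chi e z, 0).
  move=> a0; rewrite /G /k a0 subr0 clamp_id ?lexx ?ler01 // subrr scale0r.
  by rewrite add0r scale1r to_disc_id sub0r max_l // oppr_le0.
have Gf z t : sqnorm (set_val z) = 1 -> I01 t -> G (z, t) = (chi e z, 0).
  by move=> z1 _; rewrite k1 // /a /= z1 subrr mul0r mulr0.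
have [r [cr rS re]] := extend_over_cell dS eS lowS cf cG Gf.
have inS x : cellset (e |: S) x -> cellset S x \/ exists z, chi e z = x.
  move=> [e' e'S [z zx]]; move: e' e'S z zx => e'; rewrite !inE.
  move=> /orP[/eqP -> z zx|e'S z zx]; first by right; exists z.
  by left; exists e'; rewrite ?inE //; exists z.
have I0 : I01 0 by rewrite I01P lexx ler01.
have I1 : I01 1 by rewrite I01P lexx ler01.
exists (e |: S); split.
- move=> e1 e2; rewrite !inE => /orP[/eqP ->|e1e] e21; first by rewrite e21 orbT.
  by rewrite (ltn_trans e21) ?orbT.
- by exists e; rewrite ?inE ?eqxx //; exists c.
exists r; split=> //.
- move=> x /inS[Sx|[z <-]]; first by rewrite rS.
  by rewrite re // k1 // /a /= clamp_id ?lexx ?ler01 // mulr0 mul0r.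
- move=> t t01; rewrite -cx0 !re // /G /= -scalerDl subrK scale1r to_disc_id.
  split=> //; rewrite /a /= clamp_id ?lexx ?ler01 // divff; last first.
    by rewrite subr_eq0 gt_eqF.
  by rewrite max_r; lra.
- move=> x t /inS[Sx|[z <-]] t01; first by rewrite rS //=; split; [|left].
  rewrite re // /G /= le_max lexx; split=> //.
  case: (lerP (a (z, t) - 1) 0) => a1; first by left.
  right; have -> : k (z, t) = 0 by rewrite /k clamp_le0 //; lra.
  by rewrite subr0 scale1r scale0r addr0 to_disc_id.
Qed.

(** Induction on the number of missing cells: one of minimal dimension can be added. *)
Lemma cw_nondegenerate : nondegenerate_point R x0.
Proof.
have [S [dS Sx0 nS]] := own_cell_nondegenerate.
have {S dS Sx0 nS} : partial_nondegenerate setT.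
  have [k] := ubnP #|~: S|; elim: k S dS Sx0 nS => // k IH S dS Sx0 nS Sk.
  case: (pickP (fun e => e \notin S)) => [e1 e1S|allS]; last first.
    suff <- : cellset S = setT by [].
    apply/seteqP; split=> // p _; have [e [z _ <-]] := @cw_cover R X C p.
    by exists e; [move: (allS e) => /negbFE|exists z].
  case: (@arg_minnP _ e1 (fun e => e \notin S) dim e1S) => e eS emin.
  have lowS e' : (dim e' < dim e)%N -> e' \in S.
    by move=> e'e; apply: contraTT e'e => /emin; rewrite -leqNgt.
  apply: (IH (e |: S)).
  - move=> e2 e3; rewrite !inE => /orP[/eqP ->|e2S] e32.
      by rewrite lowS ?orbT.
    by rewrite (dS _ _ e2S e32) orbT.
  - by case: Sx0 => e2 e2S [z zx]; exists e2; rewrite ?inE ?e2S ?orbT //; exists z.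
  - exact: add_cell_nondegenerate.
  - rewrite -ltnS (leq_trans _ Sk) // ltnS; apply: proper_card.
    rewrite properE; apply/andP; split.
      by apply/fintype.subsetP => e2; rewrite !inE negb_or => /andP[].
    apply/negP => /fintype.subsetP /(_ e); rewrite !inE eqxx.
    by move=> /(_ eS).
move=> [r [cr r0 rx rP]].
have I0 : I01 0 by rewrite I01P lexx ler01.
have I1 : I01 1 by rewrite I01P lexx ler01.
have Ic t : I01 (clamp t) by rewrite I01P clamp_itv.
exists (fun p => r (p.1, clamp p.2)); split=> /=.
- move=> p; apply: (at_within cr); last first.
    by apply: (@filterS _ (nbhs p) _ setT) => [q _|]; [split=> //; exact: Ic|exact: filterT].
  by apply: at_pair; [cts|apply: at_clamp; cts].
- by move=> x; rewrite clamp_id ?lexx ?ler01 // r0.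
- move=> t; rewrite [clamp 1]clamp_id ?lexx ?ler01 //; exact: rx.
- by move=> x t; exact: rP.
Qed.

End CWNondegenerate.

(** * Maps from a sphere to a sphere of higher dimension *)

Section MissingDirection.
Variables (R : realType) (m : nat).

Lemma dotx0 (u : 'rV[R]_m) : dot u 0 = 0.
Proof. by rewrite -(scale0r 0) dotZr mul0r. Qed.

Lemma dot_sumr I (r : seq I) (P : pred I) (u : 'rV[R]_m) (F : I -> 'rV[R]_m) :
  dot u (\sum_(i <- r | P i) F i) = \sum_(i <- r | P i) dot u (F i).
Proof.
elim/big_rec2: _ => [|i y x _ <-]; last by rewrite dotDr.
by rewrite dotx0.
Qed.

Lemma orthogonal_exists (k : nat) (c : 'I_k -> 'rV[R]_m) : (k < m)%N ->
  exists2 u : 'rV[R]_m, u != 0 & forall j, dot u (c j) = 0.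
Proof.
move=> km; pose M : 'M[R]_(m, k) := \matrix_(i, j) c j 0 i.
have : kermx M != 0.
  by rewrite kermx_eq0 /row_free neq_ltn (leq_ltn_trans (rank_leq_col M) km).
move=> /rowV0Pn[u /sub_kermxP uM u0]; exists u => // j.
have := congr1 (fun A : 'rV[R]_k => A 0 j) uM; rewrite !mxE => E.
by rewrite -[RHS]E; apply: eq_bigr => i _; rewrite mxE.
Qed.

Lemma nonroot_exists (q : {poly R}) : q != 0 -> exists t, ~~ root q t.
Proof.
move=> q0; apply: contrapT => /forallNP allr.
pose rs : seq R := [seq i%:R | i <- iota 0 (size q)].
have : (size rs < size q)%N.
  apply: max_poly_roots => //; last first.
    by rewrite map_inj_uniq ?iota_uniq // => i j /eqP; rewrite eqr_nat => /eqP.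
  by apply/allP => x _; have /negP := allr x; rewrite negbK.
by rewrite size_map size_iota ltnn.
Qed.

(** Finitely many proper subspaces do not cover the space: each one lies in the
kernel of a nonzero functional, hence meets the moment curve only at the roots
of a nonzero polynomial. *)
Lemma missing_direction (V : finType) (c : V -> 'rV[R]_m) (K : nat) : (K < m)%N ->
  exists p : 'rV[R]_m, forall (A : {set V}) (w : V -> R), (#|A| <= K)%N ->
    \sum_(a in A) w a *: c a <> p.
Proof.
move=> Km.
have L (A : {set V}) : exists u : 'rV[R]_m, (#|A| <= K)%N ->
    u != 0 /\ forall a, a \in A -> dot u (c a) = 0.
  case: (leqP #|A| K) => AK; last by exists 0.
  have [u u0 uc] := orthogonal_exists (fun j => c (@enum_val _ (mem A) j))
    (leq_ltn_trans AK Km).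
  by exists u => _; split=> // a aA; rewrite -(enum_rankK_in aA aA) uc.
pose l A := projT1 (cid (L A)).
have lP (A : {set V}) : (#|A| <= K)%N -> l A != 0 /\ forall a, a \in A -> dot (l A) (c a) = 0.
  by rewrite /l; case: cid.
pose q := \prod_(A : {set V} | (#|A| <= K)%N) rVpoly (l A).
have q0 : q != 0.
  apply/prodf_neq0 => A /lP[lA _]; apply: contraNneq lA => E.
  by rewrite -(rVpolyK (l A)) E linear0.
have [t qt] := nonroot_exists q0; pose p : 'rV[R]_m := \row_i t ^+ i.
exists p => A w AK E; have [_ lA] := lP A AK.
have lp : dot (l A) p = 0.
  by rewrite -E dot_sumr big1 // => a aA; rewrite dotZr lA // mulr0.
move/negP: qt; apply; rewrite /root horner_prod (bigD1 A) //= mulf_eq0.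
apply/orP; left; rewrite -lp horner_poly; apply/eqP; apply: eq_bigr => i _.
by rewrite valK mxE.
Qed.

End MissingDirection.

Section Nullhomotopy.
Variables (R : realType) (k m : nat) (f : usphere R k -> usphere R m).
Hypotheses (cf : continuous f) (km : (k.+1 < m)%N).
Variable x0 : usphere R k.
Local Notation Sk := (usphere R k).
Local Notation Sm := (usphere R m).

Let fv (x : Sk) : 'rV[R]_m := set_val (f x).

(** Uniform continuity on the compact sphere. The bound is [2] because two points in
the star of a common lattice vertex differ by less than [2] mesh widths in each
coordinate. *)
Lemma uniform_mesh : exists2 N : nat, (0 < N)%N & forall x x' : Sk,
  (forall i, N%:R * `|set_val x 0 i - set_val x' 0 i| < 2) ->
  sqnorm (fv x - fv x') < 1.
Proof.
have /compact_near_coveringP cS : compact [set: Sk].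
  by apply: compact_set_type; exact: usphere_compact.
pose P (N : nat) (x : Sk) := forall x' : Sk,
  (forall i, N%:R * `|set_val x 0 i - set_val x' 0 i| < 2) ->
  sqnorm (fv x - fv x') < 1.
have : \forall N \near \oo, [set: Sk] `<=` P N.
  apply: cS => x _.
  have cq : {for x, continuous (fun y => sqnorm (fv y - fv x))}.
    by apply: at_sqnorm; rewrite /fv; cts.
  have := at_lt cq (@at_cst _ _ (4^-1 : R) x).
  rewrite subrr sqnorm0 invr_gt0 ltr0n => /(_ isT).
  case=> /= _ [[W oW <-] Wx] WP.
  have : nbhs (set_val x) W by rewrite nbhsE; exists W.
  move=> /nbhs_ballP[d /= d0 dW].
  have near_x (y : Sk) : (forall i, `|set_val x 0 i - set_val y 0 i| < d) ->
      sqnorm (fv y - fv x) < 4^-1.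
    move=> yd; apply: WP; apply: dW; split=> // a b; rewrite (ord1 a); exact: yd.
  exists ([set y : Sk | ball (set_val x) (d / 2) (set_val y)],
          [set N : nat | 4 / d < N%:R]).
    split=> /=; last exact: nbhs_infty_gtr.
    apply: (@at_set_val _ _ (usphere R k) id x (@at_id _ x)).
    by apply: nbhsx_ballx; rewrite divr_gt0.
  move=> [y N] /= [xy Nd] y' yy'.
  have xy2 i : `|set_val x 0 i - set_val y 0 i| < d / 2 by have [_] := xy; apply.
  have h1 : sqnorm (fv y - fv x) < 4^-1.
    by apply: near_x => i; apply: lt_trans (xy2 i) _; rewrite ltr_pdivrMr //; lra.
  have h2 : sqnorm (fv y' - fv x) < 4^-1.
    apply: near_x => i; rewrite -(subrKA (set_val y 0 i)).
    apply: le_lt_trans (ler_normD _ _) _.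
    have N0 : 0 < N%:R :> R by apply: lt_trans Nd; rewrite divr_gt0.
    have := yy' i; have := xy2 i; move: Nd; rewrite ltr_pdivrMr // => Nd.
    set a := `|_ - _|; set b := `|_ - _| => ad nb.
    have : N%:R * b < N%:R * (d / 2) by lra.
    by rewrite ltr_pM2l //; lra.
  have -> : fv y - fv y' = (fv y - fv x) - (fv y' - fv x).
    by rewrite opprB addrA subrK.
  move: (fv y - fv x) (fv y' - fv x) h1 h2 => u w h1 h2.
  by have := sqnorm_ge0 (u + w); rewrite sqnormB sqnormD; lra.
move=> H; have [N [N1 NP]] := @filter_ex _ \oo _ _ (filterI (nbhs_infty_ge 1) H).
by exists N => // x x'; exact: NP.
Qed.

Section Lattice.
Variables (N : nat) (N_gt0 : (0 < N)%N).
Hypothesis mesh : forall x x' : Sk,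
  (forall i, N%:R * `|set_val x 0 i - set_val x' 0 i| < 2) ->
  sqnorm (fv x - fv x') < 1.

Definition vertex : finType := {ffun 'I_k -> 'I_(2 * N).+1}.

Definition scaled (x : Sk) (i : 'I_k) : R := N%:R * (set_val x 0 i + 1).

Definition offset (a : vertex) (x : Sk) (i : 'I_k) : R := scaled x i - (a i)%:R.

(** The open star of the vertex [a] in the Freudenthal triangulation of the lattice
is cut out by [|y_i| < 1] and [y_i - y_j < 1], for the offset [y] from [a]; the
product of the corresponding hinge functions is a bump function of this star. *)
Definition bump (a : vertex) (x : Sk) : R :=
  \prod_i (Num.max 0 (1 - offset a x i) * Num.max 0 (1 + offset a x i)) *
  \prod_i \prod_j Num.max 0 (1 - (offset a x i - offset a x j)).

Lemma bump_ge0 a x : 0 <= bump a x.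
Proof.
apply: mulr_ge0; apply: prodr_ge0 => i _.
  by rewrite mulr_ge0 // le_max lexx.
by apply: prodr_ge0 => j _; rewrite le_max lexx.
Qed.

Lemma bump_gt0P a x : 0 < bump a x ->
  (forall i, -1 < offset a x i < 1) /\
  (forall i j, offset a x i - offset a x j < 1).
Proof.
rewrite lt_neqAle bump_ge0 andbT eq_sym mulf_eq0 negb_or.
move=> /andP[/prodf_neq0 h1 /prodf_neq0 h2]; split=> [i|i j].
  have := h1 i isT; rewrite mulf_eq0 negb_or => /andP[].
  rewrite !eq_le !le_max !ge_max !lexx !andbT /= -!ltNge; lra.
have /prodf_neq0/(_ j isT) := h2 i isT.
rewrite !eq_le !le_max !ge_max !lexx !andbT /= -!ltNge; lra.
Qed.

Lemma bump_continuous a : continuous (bump a).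
Proof.
move=> x.
have co i : {for x, continuous (fun x => offset a x i)}.
  by rewrite /offset /scaled; cts.
rewrite /bump; apply: at_mul; apply: at_prod => i.
  by have := co i => ?; cts.
by apply: at_prod => j; have := co i => ?; have := co j => ?; cts.
Qed.

Lemma scaled_itv x i : 0 <= scaled x i <= (2 * N)%:R.
Proof.
have : `|set_val x 0 i| <= 1.
  rewrite -(@expr_le1 _ 2) ?normr_ge0 // real_normK ?num_real // -(usphereE x).
  by rewrite /sqnorm (bigD1 i) //= lerDl sumr_ge0 // => j _; exact: sqr_ge0.
rewrite ler_norml => /andP[x1 x2].
rewrite /scaled mulr_ge0 ?ler0n //=; last lra.
by rewrite natrM mulrC ler_wpM2r ?ler0n //; lra.
Qed.

(** The lattice vertex below [x]: all vertices whose star contains [x] lie in the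
unit cube on it. *)
Definition base (x : Sk) (i : 'I_k) : nat := Num.truncn (scaled x i).

Lemma baseP x i : (base x i)%:R <= scaled x i < (base x i)%:R + 1.
Proof.
have /andP[s0 _] := scaled_itv x i; rewrite natr1.
exact: truncn_itv.
Qed.

Lemma bump_exists x : exists a, 0 < bump a x.
Proof.
have b_lt i : (base x i < (2 * N).+1)%N.
  have /andP[_ s2] := scaled_itv x i; have /andP[b1 _] := baseP x i.
  by rewrite ltnS -(ler_nat R) (le_trans b1).
exists [ffun i => Ordinal (b_lt i)].
have o01 i : 0 <= offset [ffun i => Ordinal (b_lt i)] x i < 1.
  by rewrite /offset ffunE /=; have := baseP x i; lra.
rewrite /bump mulr_gt0 //; apply: prodr_gt0 => i _.
  by have := o01 i => ?; rewrite mulr_gt0 // lt_max; apply/orP; right; lra.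
apply: prodr_gt0 => j _; have := o01 i; have := o01 j => ? ?.
by rewrite lt_max; apply/orP; right; lra.
Qed.

Lemma active_base a x i : 0 < bump a x -> (base x i <= a i <= (base x i).+1)%N.
Proof.
move=> /bump_gt0P[/(_ i) o1 _]; have := baseP x i; move: o1; rewrite /offset.
by move=> o1 b1; apply/andP; split; rewrite -ltnS -(ltr_nat R) -!natr1; lra.
Qed.

(** If two vertices compared in opposite ways in two coordinates, two differences of
offsets would add up to at least [2], but each is less than [1]. *)
Lemma active_chain a a' x i j : 0 < bump a x -> 0 < bump a' x ->
  (a i < a' i)%N -> (a j <= a' j)%N.
Proof.
move=> /bump_gt0P[_ h] /bump_gt0P[_ h'] ii; rewrite leqNgt; apply/negP => jj.
have := h i j; have := h' j i; rewrite /offset.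
move: ii jj; rewrite -!(ler_nat R) -!natr1; lra.
Qed.

Definition active (x : Sk) : {set vertex} := finset (fun a => 0 < bump a x).

(** The active vertices form a chain between the base and its upper neighbour,
so they are told apart by their coordinate sums. *)
Lemma card_active x : (#|active x| <= k.+1)%N.
Proof.
set A := active x.
have AP a : a \in A = (0 < bump a x) by rewrite inE.
pose h (a : vertex) : nat := (\sum_i (a i - base x i))%N.
have h_lt a : a \in A -> (h a < k.+1)%N.
  rewrite AP ltnS => aA; rewrite -[leqRHS]card_ord -sum1_card.
  apply: leq_sum => i _; have := active_base i aA; lia.
have hI : {in A &, injective (fun a => inord (h a) : 'I_k.+1)}.
  move=> a a' aA aA' /(congr1 val); rewrite /= !inordK ?h_lt // => haa'.
  rewrite !AP in aA aA'.
  have le_eq b b' : 0 < bump b x -> 0 < bump b' x -> h b = h b' ->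
      (forall i, b i <= b' i)%N -> forall i, b i = b' i :> nat.
    move=> bA bA' hbb' bb' i; move: hbb'; rewrite /h (bigD1 i) //= [in RHS](bigD1 i) //=.
    have : (\sum_(j | j != i) (b j - base x j) <= \sum_(j | j != i) (b' j - base x j))%N.
      by apply: leq_sum => j _; rewrite leq_sub2r.
    have := bb' i; have := active_base i bA; have := active_base i bA'.
    set s1 := (\sum_(_ | _) _)%N; set s2 := (\sum_(_ | _) (b' _ - _))%N.
    move: (nat_of_ord (b i)) (nat_of_ord (b' i)) (base x i) s1 s2 => u w z s1 s2.
    move=> /andP[? ?] /andP[? ?] ? ? ?; lia.
  apply/ffunP => i; apply: val_inj.
  case: (pselect (exists j, (a j < a' j)%N)) => [[j jj]|/forallNP nlt].
    by apply: (le_eq a a') => // i'; exact: (active_chain _ aA aA' jj).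
  apply/esym; apply: (le_eq a' a) => // i'.
  by rewrite leqNgt; apply/negP; exact: nlt.
by rewrite -(card_in_imset hI) -[leqRHS]card_ord max_card.
Qed.

Definition sample (a : vertex) : 'rV[R]_m := fv (xget x0 [set s | 0 < bump a s]).

Definition approx (x : Sk) : 'rV[R]_m := \sum_a bump a x *: sample a.

Lemma approx_continuous : continuous approx.
Proof.
move=> x; apply: at_row => i.
apply: (@at_eq _ _ (fun x => \sum_a bump a x * sample a 0 i)) => [y|].
  by rewrite /approx summxE; apply: eq_bigr => a _; rewrite mxE.
apply: at_sum => a; have := @bump_continuous a => ca.
by cts.
Qed.

Lemma dot_sample x a : 0 < bump a x -> 0 < dot (fv x) (sample a).
Proof.
move=> ax; set s := xget x0 [set s | 0 < bump a s].
have as_ : 0 < bump a s by exact: (@xgetPex _ x0 [set s | 0 < bump a s] (ex_intro _ x ax)).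
have : sqnorm (fv x - fv s) < 1.
  apply: mesh => i; have [/(_ i) o1 _] := bump_gt0P ax; have [/(_ i) o2 _] := bump_gt0P as_.
  have N0 : 0 <= N%:R :> R by rewrite ler0n.
  rewrite -[X in X * _](ger0_norm N0) -normrM ltr_norml.
  by move: o1 o2; rewrite /offset /scaled; lra.
by rewrite sqnormB /fv !usphereE -/(fv x) /sample -/s /fv; lra.
Qed.

(** All samples that contribute at [x] are close to [f x], so they lie in the open
half-space around it. Hence the segment from [f x] to the approximation avoids the
origin. *)
Lemma dot_approx x : 0 < dot (fv x) (approx x).
Proof.
rewrite /approx dot_sumr; have [a ax] := bump_exists x.
have ge0 b : 0 <= dot (fv x) (bump b x *: sample b).
  rewrite dotZr; have := bump_ge0 b x; rewrite le_eqVlt => /orP[/eqP <-|bx].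
    by rewrite mul0r.
  by rewrite mulr_ge0 ?bump_ge0 // ltW // dot_sample.
rewrite (bigD1 a) //= ltr_wpDr //; first exact: sumr_ge0.
by rewrite dotZr mulr_gt0 // dot_sample.
Qed.

(** At [x] the approximation is a combination of at most [k + 1 < m] samples, so by
[missing_direction] its direction is never that of a suitable [p]; it can be moved
linearly to [- p] without meeting the origin. *)
Lemma nullhomotopic_of_mesh : exists q : Sm, line_homotopic R f (fun=> q).
Proof.
have [p pP] := missing_direction sample km.
have approx_p x (w : R) : w *: approx x <> p.
  move=> E; apply: (pP (active x) (fun a => w * bump a x)).
    exact: card_active.
  rewrite -E /approx scaler_sumr big_mkcond /=; apply: eq_bigr => a _.
  rewrite inE scalerA; case: ltgtP (bump_ge0 a x) => // <- _.
  by rewrite mulr0 scale0r.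
have approx0 x : approx x != 0.
  by apply: contraTneq (dot_approx x) => ->; rewrite dotx0 ltxx.
pose y0 := f x0.
have ca := approx_continuous.
have nz1 x t : (1 - clamp t) *: fv x + clamp t *: approx x != 0.
  have /andP[t0 t1] := clamp_itv t.
  have : 0 < dot (fv x) ((1 - clamp t) *: fv x + clamp t *: approx x).
    rewrite dotDr !dotZr dotxx /fv usphereE -/(fv x) mulr1.
    have := dot_approx x; set d := dot _ _ => d0.
    have [->|tn0] := eqVneq (clamp t) 0; first by lra.
    rewrite ltr_wpDl ?mulr_gt0 ?lt_def ?tn0 //; lra.
  by apply: contraTneq => ->; rewrite dotx0 ltxx.
have nz2 x t : (1 - clamp t) *: approx x - clamp t *: p != 0.
  rewrite subr_eq0; have [->|tn0] := eqVneq (clamp t) 0.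
    by rewrite subr0 scale1r scale0r approx0.
  apply/eqP => E; apply: (approx_p x ((clamp t)^-1 * (1 - clamp t))).
  by rewrite -scalerA E scalerA mulVf // scale1r.
exists (normalize y0 (- p)); apply: (@line_homotopic_trans _ _ _
  (fun x => normalize y0 (approx x))).
- pose g (q : Sk * R) := (1 - clamp q.2) *: fv q.1 + clamp q.2 *: approx q.1.
  exists (fun q => normalize y0 (g q)); split=> [q|x|x]; rewrite /g /=.
  + apply: (@at_normalize R _ m y0 g q); first exact: nz1.
    have cc : {for q, continuous (fun q : Sk * R => clamp q.2)}.
      by apply: at_clamp; cts.
    by rewrite /g /fv; cts.
  + by rewrite clamp_le0 // subr0 scale1r scale0r addr0 normalize_id.
  + by rewrite clamp_ge1 // subrr scale1r scale0r add0r.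
- pose g (q : Sk * R) := (1 - clamp q.2) *: approx q.1 - clamp q.2 *: p.
  exists (fun q => normalize y0 (g q)); split=> [q|x|x]; rewrite /g /=.
  + apply: (@at_normalize R _ m y0 g q); first exact: nz2.
    have cc : {for q, continuous (fun q : Sk * R => clamp q.2)}.
      by apply: at_clamp; cts.
    by rewrite /g; cts.
  + by rewrite clamp_le0 // subr0 scale1r scale0r subr0.
  + by rewrite clamp_ge1 // subrr scale1r scale0r sub0r.
Qed.

End Lattice.

Lemma sphere_map_nullhomotopic : exists q : Sm, line_homotopic R f (fun=> q).
Proof. by have [N N0 mesh] := uniform_mesh; exact: nullhomotopic_of_mesh mesh. Qed.

End Nullhomotopy.

Section SphereConnected.
Variables (R : realType) (m : nat).
Hypothesis m_gt1 : (1 < m)%N.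
Local Notation S := (usphere R m).

Lemma line_connected : connected [set: R].
Proof. by apply/connected_intervalP => x y _ _ z _. Qed.

(** Any two points are joined by arcs to a third point that is on neither of the two
lines through the origin and one of them. *)
Lemma usphere_connected : connected [set: S].
Proof.
case: (pselect (exists a : S, True)) => [[a _]|nS]; last first.
  suff -> : [set: S] = set0 by exact: connected0.
  by apply/seteqP; split=> // x _; case: nS; exists x.
suff <- : connected_component [set: S] a = [set: S] by exact: component_connected.
apply/seteqP; split=> // b _.
have [p pP] := @missing_direction R m bool
  (fun i => if i then set_val a else set_val b) 1 m_gt1.
have arc i (x := if i then a else b) :
    connected_component [set: S] x (normalize a p).
  have nz t : (1 - t) *: set_val x + t *: p != 0.
    apply/eqP; have [->|t0] := eqVneq t 0.
      rewrite subr0 scale1r scale0r addr0 => x0; have := usphereE x.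
      by rewrite x0 sqnorm0 => /eqP; rewrite eq_sym oner_eq0.
    move=> /eqP; rewrite addrC addr_eq0 => /eqP E.
    apply: (pP (finset.set1 i) (fun=> - (t^-1 * (1 - t)))); first by rewrite cards1.
    rewrite finset.big_set1.
    have -> : (if i then set_val a else set_val b) = set_val x by rewrite /x; case: (i).
    by rewrite scaleNr -scalerA -scalerN -E scalerA mulVf // scale1r.
  pose w (t : R) := (1 - t) *: set_val x + t *: p.
  pose ga t := normalize a (w t).
  have cga : continuous ga.
    move=> t; apply: (@at_normalize R _ m a w t); first exact: nz.
    by rewrite /w; cts.
  have ga0 : range ga x.
    by exists 0 => //; rewrite /ga /w subr0 scale1r scale0r addr0 normalize_id.
  have ga1 : range ga (normalize a p).
    by exists 1 => //; rewrite /ga /w subrr scale0r scale1r add0r.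
  have gac : connected (range ga).
    apply: connected_continuous_connected line_connected _.
    exact: continuous_subspaceT.
  exact: (@connected_component_max _ [set: S] (range ga) x ga0 (@subsetT _ _) gac).
apply: connected_component_trans (arc true) _.
by apply: connected_component_sym; exact: (arc false).
Qed.

End SphereConnected.

(** * Path connectedness of the base *)

Section BaseConnected.
Variable R : realType.

(** A clopen set of the base contains all or none of the attached sphere, so it
extends to a clopen set of the attaching space. *)
Lemma attach_cell_connected_base (m : nat) (N0 : topologicalType)
    (g : usphere R m -> N0) : continuous g -> connected [set: usphere R m] ->
  connected [set: attach_cell g] -> connected [set: N0].
Proof.
move=> cg cS cA B [b Bb] [C oC BC] [D cD BD].
have {C oC BC} oB : open B by rewrite BC setTI.
have {D cD BD} cB : closed B by rewrite BD setTI.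
have /continuousP cgo := cg.
have ogB : open (g @^-1` B) by exact: cgo.
have cgB : closed (g @^-1` B) by have /continuous_closedP := cg; exact.
pose e := `[< exists s, B (g s) >].
have eE s : `[< B (g s) >] = e.
  apply/asboolP/asboolP => [Bs|[s' Bs']]; first by exists s.
  have := cS (g @^-1` B).
  have h : g @^-1` B !=set0 by exists s'.
  move=> /(_ h) /(_ (ex_intro2 _ _ _ ogB (esym (setTI _)))).
  move=> /(_ (ex_intro2 _ _ _ cgB (esym (setTI _)))) gT.
  by have : (g @^-1` B) s by rewrite gT.
pose W : set (attach_cell g) := pushout_rec (fun x => `[< B x >]) (fun _ => e).
have Wl x : W (pushout_inl g (@sphere_incl R m) x) = B x.
  by rewrite /W pushout_rec_inl // asboolE.
have Wr d : W (pushout_inr g (@sphere_incl R m) d) = e.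
  by rewrite /W pushout_rec_inr.
have preW (E : bool -> bool) : open [set x | E `[< B x >]] ->
    open [set w : attach_cell g | E (pushout_rec (fun x => `[< B x >]) (fun _ => e) w)].
  move=> oE; apply/(quot_proj_identification _).2; split.
    suff -> : inl @^-1` (quot_proj (pushout_rel g (@sphere_incl R m)) @^-1`
      [set w | E (pushout_rec (fun x => `[< B x >]) (fun=> e) w)]) =
      [set x | E `[< B x >]] by [].
    by apply/seteqP; split=> x /=; rewrite pushout_rec_inl.
  have -> : inr @^-1` (quot_proj (pushout_rel g (@sphere_incl R m)) @^-1`
      [set w | E (pushout_rec (fun x => `[< B x >]) (fun=> e) w)]) =
      [set d | E e].
    by apply/seteqP; split=> x /=; rewrite pushout_rec_inr.
  have -> : [set d : udisc R m | E e] = if E e then setT else set0.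
    by apply/seteqP; case: (E e); split.
  by case: (E e); [exact: openT|exact: open0].
have oW : open W.
  by apply: (preW id); rewrite (_ : [set _ | _] = B) //; apply/seteqP; split=> x /asboolP.
have cW : closed W.
  rewrite -(setCK W); apply: open_closedC.
  have -> : ~` W = [set w : attach_cell g |
      ~~ pushout_rec (fun x => `[< B x >]) (fun=> e) w].
    by apply/seteqP; split=> w /negP.
  apply: (preW negb); rewrite (_ : [set _ | _] = ~` B); first exact: closed_openC.
  by apply/seteqP; split=> x /= /asboolPn.
have W0 : W !=set0 by exists (pushout_inl g (@sphere_incl R m) b); rewrite Wl.
have WT := cA W W0 (ex_intro2 _ _ _ oW (esym (setTI _)))
  (ex_intro2 _ _ _ cW (esym (setTI _))).
by apply/seteqP; split=> // x _; rewrite -Wl WT.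
Qed.

Variables (X Y : topologicalType).
Hypotheses (ndY : forall y : Y, nondegenerate_point R y) (cY : connected [set: Y]).

(** The points that reach positive level at time [1] have been moved to [y]. *)
Lemma nondegenerate_near_homotopic (y : Y) :
  \forall z \near y, line_homotopic R (fun _ : X => z) (fun=> y).
Proof.
have [r [cr r0 rx rP]] := ndY y.
have c1 : {for y, continuous (fun z => (r (z, 1)).2)} by cts.
have := at_lt (@at_cst _ _ (0 : R) y) c1.
have [_ ->] := rx 1; rewrite ltr01 => /(_ isT).
apply: (@filterS _ (nbhs y)) => z zP.
have [_ [E|E]] := rP z 1; first by rewrite E ltxx in zP.
exists (fun p => (r (z, p.2)).1); split=> [p|x|x] /=.
- by cts.
- by rewrite r0.
- exact: E.
Qed.

(** Path components are open near nondegenerate points. *)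
Lemma constant_maps_homotopic (y y' : Y) :
  line_homotopic R (fun _ : X => y) (fun=> y').
Proof.
pose U := [set z | line_homotopic R (fun _ : X => y) (fun=> z)].
have oU : open U.
  rewrite openE => z Uz; have := nondegenerate_near_homotopic z.
  apply: (@filterS _ (nbhs z)) => w wz; apply: line_homotopic_trans Uz _.
  exact: line_homotopic_sym.
have cU : closed U.
  rewrite -(setCK U); apply: open_closedC; rewrite openE => z nUz.
  have := nondegenerate_near_homotopic z.
  apply: (@filterS _ (nbhs z)) => w wz Uw; apply: nUz.
  exact: line_homotopic_trans Uw wz.
have U0 : U !=set0 by exists y; apply: line_homotopic_refl => x; exact: at_cst.
have UT := cY U0 (ex_intro2 _ _ _ oU (esym (setTI _)))
  (ex_intro2 _ _ _ cU (esym (setTI _))).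
by have : U y' by rewrite UT.
Qed.

End BaseConnected.

Section SumAt1.
Variables (X Y Z : topologicalType).

Lemma at_inl1 (F : X + Y -> Z) (x : X) :
  {for x, continuous (fun z => F (inl z))} -> {for inl x, continuous F}.
Proof. by move=> cF W /cF nW; apply: nbhs_inl. Qed.

Lemma at_inr1 (F : X + Y -> Z) (y : Y) :
  {for y, continuous (fun z => F (inr z))} -> {for inr y, continuous F}.
Proof. by move=> cF W /cF nW; apply: nbhs_inr. Qed.

End SumAt1.

(** * The punctured gyration *)

Section PuncturedGyration.
Variables (R : realType) (n : nat) (N0 : topologicalType).
Local Notation S := (usphere R (2 * n)).
Local Notation B := (usphere R n).
Local Notation D := (udisc R n).
Variables (g : S -> N0) (tau : B -> self_equivs R (2 * n)).
Hypotheses (cg : continuous g) (ctau : continuous tau).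
Variables (y : S) (v : D) (s0 : B).
Hypothesis v_int : sqnorm (set_val v) < 1.

Local Notation left := (gyration_left g tau).
Local Notation right := (@gyration_right R n).
Local Notation G := (gyration g tau).
Local Notation inZ := (pushout_inl left right).
Local Notation inSD := (pushout_inr left right).
Local Notation G' := (gyration_minus g tau (y, v)).

(** The sphere is locally compact, so uncurrying preserves continuity. *)
Lemma evaluation_continuous :
  continuous (fun p : B * S => (set_val (tau p.1) : S -> S) p.2).
Proof.
have lc : locally_compact [set: S].
  move=> x _; exists setT; first by rewrite withinET; exact: filterT.
  by split; [apply: compact_set_type; exact: usphere_compact|exact: closedT].
have hS : hausdorff_space S by apply: hausdorff_set_type; exact: rV_hausdorff.
pose ev (s : B) : {compact-open, S -> S} := set_val (tau s).
have cev : continuous ev by move=> s; rewrite /ev; cts.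
have evc s : continuous (ev s : S -> S) by have [] := set_mem (valP (tau s)).
have := @continuous_uncurry B S S ev lc hS cev evc.
move=> H p; apply: (@at_eq _ _ (uncurry ev)) => [[]//|]; exact: H.
Qed.

Lemma left_continuous : continuous left.
Proof.
move=> p; have cev := evaluation_continuous.
apply: (@at_pair _ _ _ (fun p : S * B => g (set_val (tau p.2) p.1)) snd p); last by cts.
apply: (@at_comp _ _ _ (fun p : S * B => (set_val (tau p.2) : S -> S) p.1) g p).
  apply: (@at_comp _ _ _ (fun p : S * B => (p.2, p.1))
    (fun p : B * S => (set_val (tau p.1) : S -> S) p.2) p); first by cts.
  exact: cev.
exact: cg.
Qed.

Let box (p : S * (B * R)) : S * D := (p.1, polar v p.2).

Lemma box_identification : identification box.
Proof.
apply: (@compact_identification _ _ box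
  ([set: S] `*` ([set: B] `*` `[0, 1 : R]%classic))).
- by apply: hausdorff_prod; apply: hausdorff_set_type; exact: rV_hausdorff.
- by move=> p; rewrite /box; have cp := @polar_continuous R n v; cts.
- apply: compact_setX; last exact: polar_box_compact.
  by apply: compact_set_type; exact: usphere_compact.
- move=> [x d]; have [p p01 pd] := polar_surj v s0 d.
  by exists (x, p); [split=> //=; split|rewrite /box pd].
Qed.

Let cover_id := pushout_cover_identification left right box_identification.

(** The removed point lies off the glued part, so its class is a singleton. *)
Lemma removed_class (u : (N0 * B) + (S * D)) :
  quot_proj (pushout_rel left right) u = inSD (y, v) -> u = inr (y, v).
Proof.
pose P (u : (N0 * B) + (S * D)) := u = inr (y, v).
have PE w : quot_lift P (quot_proj (pushout_rel left right) w) = P w.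
  apply: quot_liftE => a b [[x s] [-> ->]]; rewrite propeqE /P; split=> //.
  rewrite /right /= => -[_ E]; have := v_int.
  by rewrite -E /sphere_incl /= -[X in sqnorm X]/(set_val s) usphereE ltxx.
by move=> E; rewrite -/(P u) -PE E PE.
Qed.

Lemma inZ_punctured z : G' (inZ z).
Proof. by move=> /removed_class. Qed.

Lemma inSD_punctured d : G' (inSD d) <-> d <> (y, v).
Proof.
split=> [Gd E|dn]; first by apply: Gd; rewrite E.
by move=> /removed_class [] /dn.
Qed.

Lemma punctured_open : open G'.
Proof.
apply/(quot_proj_identification _).2; split.
  have -> : inl @^-1` (quot_proj (pushout_rel left right) @^-1` G') = setT.
    by apply/seteqP; split=> // z _; exact: inZ_punctured.
  exact: openT.
have -> : inr @^-1` (quot_proj (pushout_rel left right) @^-1` G') = ~` [set (y, v)].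
  by apply/seteqP; split=> d /inSD_punctured.
apply: closed_openC; apply: closed_pt.
by apply: hausdorff_prod; apply: hausdorff_set_type; exact: rV_hausdorff.
Qed.

Lemma polar_punctured x s r : G' (inSD (x, polar v (s, r))) -> x <> y \/ 0 < clamp r.
Proof.
move=> /inSD_punctured xr; have /andP[r0 _] := clamp_itv r.
case: (ltP 0 (clamp r)) => r1; [by right|left=> xy; apply: xr].
have rE : clamp r = 0 by apply/eqP; rewrite eq_le r1.
by rewrite xy -polar_clamp rE polar0.
Qed.

Fact antipode_proof : - set_val y \in usphere R (2 * n).
Proof. by apply/mem_set; rewrite /usphere /= sqnormN usphereE. Qed.

Definition antipode : S := exist _ (- set_val y) antipode_proof.

(** The height of [x] over [y]: it is [0] at [y] only and [1] at the antipode. *)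
Definition height (x : S) : R := sqnorm (set_val x - set_val y) / 4.

Lemma height_itv x : 0 <= height x <= 1.
Proof.
rewrite /height divr_ge0 ?sqnorm_ge0 //= ler_pdivrMr // mul1r.
have := sqnorm_ge0 (set_val x + set_val y).
by rewrite sqnormD sqnormB !usphereE; lra.
Qed.

Lemma height_gt0 x : x <> y -> 0 < height x.
Proof.
move=> xy; rewrite /height divr_gt0 // lt_def sqnorm_ge0 andbT sqnorm_eq0 subr_eq0.
by apply/eqP => /usphere_inj.
Qed.

Lemma height_antipode : height antipode = 1.
Proof.
rewrite /height /antipode /= -[X in sqnorm (X - _)]/(- set_val y) -opprD sqnormN.
by rewrite -mulr2n -scaler_nat sqnormZ usphereE; lra.
Qed.

Lemma height_continuous : continuous height.
Proof.
move=> x; have c : {for x, continuous (fun x : S => sqnorm (set_val x - set_val y))}.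
  by apply: at_sqnorm; cts.
by rewrite /height; cts.
Qed.

Definition chord (x : S) (l : R) := (1 - l) *: set_val x - l *: set_val y.

(** The point of [S] above the chord from [x] to the antipode of [y] *)
Definition slide (x : S) (l : R) : S := normalize y (chord x l).

Lemma chord_neq0 x l : x <> y \/ l = 0 -> chord x l != 0.
Proof.
move=> xl; apply/eqP => /eqP; rewrite /chord subr_eq0 => /eqP E.
have E2 := congr1 (@sqnorm R _) E; rewrite !sqnormZ !usphereE !mulr1 in E2.
have l2 : l = 1 / 2 by move: E2; rewrite !expr2; lra.
case: xl => [xy|l0]; last by move: l2; rewrite l0; lra.
apply: xy; apply: usphere_inj; move: E; rewrite l2.
rewrite (_ : 1 - 1 / 2 = 1 / 2 :> R); last by lra.
by apply: scalerI; lra.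
Qed.

Lemma slide0 x : slide x 0 = x.
Proof. by rewrite /slide /chord subr0 scale1r scale0r subr0 normalize_id. Qed.

Lemma slide1 x : slide x 1 = antipode.
Proof.
rewrite /slide /chord subrr scale0r scale1r sub0r.
exact: (normalize_id y antipode).
Qed.

Lemma slide_antipode l : slide antipode l = antipode.
Proof.
rewrite /slide /chord -[set_val antipode]/(- set_val y) scalerN -opprD -scalerDl.
rewrite subrK scale1r; exact: (normalize_id y antipode).
Qed.

(** The point [y] is the only one whose chord to the antipode passes the origin, and
the other chords stay off the ray of [y]. *)
Lemma slide_neq x l : x <> y -> 0 <= l <= 1 -> slide x l <> y.
Proof.
move=> xy /andP[l0 l1] /(congr1 set_val); have c0 : chord x l != 0.
  by apply: chord_neq0; left.
rewrite normalizeE // => E; set c := enorm (chord x l) in E.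
have cp : 0 < c by rewrite enorm_gt0.
have {}E : (1 - l) *: set_val x = (c + l) *: set_val y.
  have cy : c *: set_val y = chord x l.
    by rewrite -[in LHS]E scalerA divff ?scale1r // gt_eqF.
  by rewrite [RHS]scalerDl cy /chord subrK.
have E2 := congr1 (@sqnorm R _) E; rewrite !sqnormZ !usphereE !mulr1 in E2.
have lc : 1 - l = c + l.
  have /eqP := E2; rewrite eqf_sqr => /orP[/eqP//|/eqP h]; lra.
apply: xy; apply: usphere_inj; move: E; rewrite lc; apply: scalerI.
by rewrite gt_eqF //; lra.
Qed.

Lemma antipode_neq : antipode <> y.
Proof. by rewrite -(slide1 antipode) slide_antipode => E; move: height_antipode; rewrite E /height subrr sqnorm0 mul0r => /eqP; rewrite eq_sym oner_eq0. Qed.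

(** How far to slide [x] towards the antipode at radius [r]: all the way where
[r <= height x / 2], not at all where [height x <= r]. *)
Definition drift (x : S) (r : R) : R := clamp (3 * (height x - r) / (height x + r)).

Lemma drift1 x r : 0 <= r -> 0 < height x -> r <= height x / 2 -> drift x r = 1.
Proof. by move=> r0 h0 rh; rewrite /drift clamp_ge1 // ler_pdivlMr; lra. Qed.

Lemma drift0 x r : 0 <= r -> height x <= r -> drift x r = 0.
Proof.
move=> r0 rh; have /andP[h0 _] := height_itv x; rewrite /drift clamp_le0 //.
by rewrite mulr_le0_ge0 ?invr_ge0; lra.
Qed.

Lemma drift_y r : 0 <= r -> drift y r = 0.
Proof. by move=> r0; apply: drift0 => //; rewrite /height subrr sqnorm0 mul0r. Qed.

Lemma drift_chord_neq0 x r c : 0 <= r -> x <> y \/ 0 < r ->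
  chord x (c * drift x r) != 0.
Proof.
move=> r0 xr; apply: chord_neq0.
have [xy|] := pselect (x = y); last by left.
by right; rewrite xy drift_y // mulr0.
Qed.

Lemma height_radius_gt0 x r : 0 <= r -> x <> y \/ 0 < r -> 0 < height x + r.
Proof.
have /andP[h0 _] := height_itv x.
by move=> r0 [/height_gt0|r1]; lra.
Qed.

Lemma at_drift (T : topologicalType) (X : T -> S) (rho : T -> R) (t : T) :
  {for t, continuous X} -> {for t, continuous rho} ->
  0 < height (X t) + rho t -> {for t, continuous (fun z => drift (X z) (rho z))}.
Proof.
move=> cX cr hr; have ch := height_continuous.
apply: at_clamp; apply: at_mul; first by cts.
by apply: at_inv; [rewrite gt_eqF|cts].
Qed.

Lemma at_slide (T : topologicalType) (X : T -> S) (l : T -> R) (t : T) :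
  {for t, continuous X} -> {for t, continuous l} -> chord (X t) (l t) != 0 ->
  {for t, continuous (fun z => slide (X z) (l z))}.
Proof.
move=> cX cl h; apply: (@at_normalize R _ _ y (fun z => chord (X z) (l z)) t h).
by rewrite /chord; cts.
Qed.

Definition section_attaching (s : B) : N0 * B := left (antipode, s).
Local Notation al := section_attaching.
Local Notation A := (attach_cell al).
Local Notation inA := (pushout_inl al (@sphere_incl R n)).
Local Notation inC := (pushout_inr al (@sphere_incl R n)).

Lemma glue x s : inZ (left (x, s)) = inSD (x, polar v (s, 1)).
Proof. by rewrite polar1; exact: (@pushout_glue _ _ _ left right (x, s)). Qed.

Lemma polar_coord_polar s r : 0 <= r <= 1 ->
  (polar_coord v s0 (polar v (s, r))).2 = r /\
  (r = 0 \/ (polar_coord v s0 (polar v (s, r))).1 = s).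
Proof.
move=> r01; have := polar_coord_itv v s0 (polar v (s, r)).
have := polar_coordK v s0 (polar v (s, r)).
case: (polar_coord _ _ _) => s' r' /= E r01'.
by have [<- [->|->]] := polar_inj v_int r01' r01 E; split=> //; [left|right].
Qed.

(** Polar coordinates are unique except at the centre, where [c] ignores the
direction over every [x] other than [y]. *)
Lemma polar_coord_punctured (Y : Type) (c : S * (B * R) -> Y) x s r :
  (x <> y -> forall s s', c (x, (s, 0)) = c (x, (s', 0))) ->
  x <> y \/ 0 < clamp r ->
  c (x, polar_coord v s0 (polar v (s, r))) = c (x, (s, clamp r)).
Proof.
move=> c0 xr; rewrite -polar_clamp.
have [] := polar_coord_polar s (clamp_itv r).
case: (polar_coord _ _ _) => s' r' /= -> [r0|-> //].
case: xr => [xy|]; last by rewrite r0 ltxx.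
by rewrite r0; exact: c0.
Qed.

(** The end of the deformation, with values in the attaching space: where
[height x / 2 <= r] the radius has become [1]; where [r <= height x / 2] the point
[x] has become the antipode. Where both hold the attaching relation identifies
the two formulas. *)
Definition push_cell (p : S * (B * R)) : A :=
  if height p.1 / 2 <= p.2.2
  then inA (left (slide p.1 (drift p.1 p.2.2), p.2.1))
  else inC (polar v (p.2.1, 2 * p.2.2 / height p.1)).

Definition push : G -> A :=
  pushout_rec inA (fun d => push_cell (d.1, polar_coord v s0 d.2)).

Let push_cell0 x : x <> y -> forall s s', push_cell (x, (s, 0)) = push_cell (x, (s', 0)).
Proof.
move=> /height_gt0 h0 s s'; rewrite /push_cell /= ifF; last first.
  by apply/negbTE; rewrite -ltNge; lra.
by rewrite mulr0 mul0r ifF ?polar0 //; apply/negbTE; rewrite -ltNge; lra.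
Qed.

Let push_cell1 x s : push_cell (x, (s, 1)) = inA (left (x, s)).
Proof.
have /andP[_ h1] := height_itv x.
by rewrite /push_cell /= drift0 // slide0 ifT //; lra.
Qed.

Let push_compat p :
  inA (left p) = push_cell ((right p).1, polar_coord v s0 (right p).2).
Proof.
case: p => x s; rewrite /right /= -(polar1 v).
rewrite (polar_coord_punctured _ (@push_cell0 x)) clamp_ge1 // ?push_cell1 //.
by right; exact: ltr01.
Qed.

Lemma push_inl z : push (inZ z) = inA z.
Proof. by rewrite /push pushout_rec_inl; last exact: push_compat. Qed.

Lemma push_inr x s r : x <> y \/ 0 < clamp r ->
  push (inSD (x, polar v (s, r))) = push_cell (x, (s, clamp r)).
Proof.
move=> xr; rewrite /push pushout_rec_inr; last exact: push_compat.
exact: (polar_coord_punctured s (@push_cell0 x) xr).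
Qed.

Lemma push_cell_continuous (p : S * (B * R)) : p.1 <> y \/ 0 < clamp p.2.2 ->
  {for p, continuous (fun p => push_cell (p.1, (p.2.1, clamp p.2.2)))}.
Proof.
move=> xr; have /andP[r0 r1] := clamp_itv p.2.2.
have ch := height_continuous; have cleft := left_continuous.
have cA := @pushout_inl_continuous _ _ _ al (@sphere_incl R n).
have cC := @pushout_inr_continuous _ _ _ al (@sphere_incl R n).
have cp := @polar_continuous R n v.
have cc : {for p, continuous (fun p : S * (B * R) => clamp p.2.2)}.
  by apply: at_clamp; cts.
have c1 : {for p, continuous (fun p : S * (B * R) => p.1)} by cts.
have hr := height_radius_gt0 r0 xr.
apply: (@at_if R _ _ (fun p : S * (B * R) => height p.1 / 2)
   (fun p => clamp p.2.2)) => [||h|h|h].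
- by cts.
- exact: cc.
- have cs : {for p, continuous (fun p : S * (B * R) =>
      slide p.1 (drift p.1 (clamp p.2.2)))}.
    apply: at_slide => //; first exact: at_drift.
    by rewrite -[drift _ _]mul1r; exact: drift_chord_neq0.
  by cts.
- have ci : {for p, continuous (fun p : S * (B * R) => (height p.1)^-1)}.
    by apply: at_inv; [rewrite gt_eqF //; lra|cts].
  by cts.
- have h0 : 0 < height p.1 by lra.
  rewrite /= drift1 // ?h // slide1 -/(al _) (cell_glue v) -h.
  by congr (inC (polar v (_, _))); rewrite mulrCA divff // mulr1 divff ?gt_eqF.
Qed.

Lemma push_continuous w : G' w -> {for w, continuous push}.
Proof.
apply: (identification_at R cover_id punctured_open) => -[z|[x [s r]]] Gz.
  apply: at_inl1; apply: (@at_eq _ _ inA) => [z'|]; first by rewrite /= push_inl.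
  exact: pushout_inl_continuous.
apply: at_inr1; apply: at_eq_near (push_cell_continuous (polar_punctured Gz)).
have : \forall p \near ((x, (s, r)) : S * (B * R)), G' (inSD (box p)).
  have cS : continuous (fun p => inSD (box p)).
    apply: (comp_continuous (identification_continuous box_identification)).
    exact: pushout_inr_continuous.
  by apply: cS; apply: open_nbhs_nbhs; split; [exact: punctured_open|exact: Gz].
apply: (@filterS _ (nbhs (x, (s, r)))) => -[x' [s' r']] /polar_punctured xr.
by rewrite /= push_inr.
Qed.

(** The cell goes to the disc over the antipode of [y]. *)
Definition insert0 : A -> G :=
  cell_rec v s0 inZ (fun p => inSD (antipode, polar v p)).

Let insert_compat s : inZ (al s) = inSD (antipode, polar v (s, 1)).
Proof. exact: glue. Qed.

Let insert_centre s s' :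
  inSD (antipode, polar v (s, 0)) = inSD (antipode, polar v (s', 0)).
Proof. by rewrite !polar0. Qed.

Lemma insert0_inl z : insert0 (inA z) = inZ z.
Proof.
by rewrite /insert0 cell_rec_inl; [|exact: v_int|exact: insert_compat|exact: insert_centre].
Qed.

Lemma insert0_inr s r :
  insert0 (inC (polar v (s, r))) = inSD (antipode, polar v (s, r)).
Proof.
rewrite -[in RHS]polar_clamp.
by rewrite /insert0 cell_rec_inr; [|exact: v_int|exact: insert_compat|exact: insert_centre].
Qed.

Lemma insert0_punctured w : G' (insert0 w).
Proof.
apply: (@cell_ind R n v s0 _ al (fun w => G' (insert0 w))) => [z|s r r01].
  by rewrite insert0_inl; exact: inZ_punctured.
by rewrite insert0_inr; apply/inSD_punctured => -[/antipode_neq].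
Qed.

Definition insert (w : A) : G' := exist _ (insert0 w) (mem_set (@insert0_punctured w)).

Lemma insert_continuous : continuous insert.
Proof.
move=> w; apply: at_set_type; apply: cell_rec_continuous1 => //.
- exact: pushout_inl_continuous.
- have cS := @pushout_inr_continuous _ _ _ left right.
  by have cp := @polar_continuous R n v => p; cts.
Qed.

(** Over the antipode pushing doubles the radius and truncates it at [1]. *)
Lemma push_insert : line_homotopic R ((fun w : G' => push (set_val w)) \o insert) id.
Proof.
have cA := @pushout_inl_continuous _ _ _ al (@sphere_incl R n).
have cC := @pushout_inr_continuous _ _ _ al (@sphere_incl R n).
have cp := @polar_continuous R n v.
pose c (p : (B * R) * R) := inC (polar v
  (p.1.1, (1 - p.2) * Num.min 1 (2 * p.1.2) + p.2 * p.1.2)).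
have c1 s t : inA (al s) = c ((s, 1), t).
  rewrite /c /= min_l; last lra.
  by rewrite !mulr1 subrK (cell_glue v).
have c0 s s' t : c ((s, 0), t) = c ((s', 0), t).
  by rewrite /c /= min_r ?mulr0 ?addr0 ?polar0 //; lra.
exists (fun p => cell_rec v s0 inA (fun q => c (q, p.2)) p.1); split.
- apply: (@cell_rec_continuous _ _ _ v_int s0 _ _ _ (fun p => inA p.1) c) => // p.
    by cts.
  by rewrite /c; cts.
- apply: (@cell_ind R n v s0 _ al) => [z|s r r01]; rewrite /= /insert /=.
    by rewrite cell_rec_inl // -[X in push X]/(insert0 (inA z)) insert0_inl push_inl.
  rewrite cell_rec_inr // -[X in push X]/(insert0 (inC (polar v (s, r)))).
  rewrite insert0_inr push_inr; last by left; exact: antipode_neq.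
  rewrite clamp_id // /c /push_cell /= height_antipode slide_antipode subr0 !mul1r.
  rewrite mul0r addr0 divr1; case: lerP => r2.
    by rewrite min_l ?(cell_glue v) //; lra.
  by rewrite min_r //; lra.
- apply: (@cell_ind R n v s0 _ al) => [z|s r r01]; first by rewrite cell_rec_inl.
  by rewrite cell_rec_inr // clamp_id // /c /= subrr mul0r add0r mul1r.
Qed.

(** At time [1] the radius is [1] where [0 < r] and [height x / 2 <= r]. *)
Definition flow_radius (x : S) (r t : R) : R :=
  (1 - t) * r + t * (r / Num.max r (height x / 2)).

(** The deformation of the punctured product, from the identity to [push_cell]. It
fixes the part over the boundary of the disc, since the drift vanishes there. *)
Definition flow_cell (t : R) (p : S * (B * R)) : G :=
  inSD (slide p.1 (t * drift p.1 p.2.2), polar v (p.2.1, flow_radius p.1 p.2.2 t)).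

Definition flow (t : R) : G -> G :=
  pushout_rec inZ (fun d => flow_cell t (d.1, polar_coord v s0 d.2)).

Let flow_cell0 t x : x <> y -> forall s s', flow_cell t (x, (s, 0)) = flow_cell t (x, (s', 0)).
Proof.
by move=> _ s s'; rewrite /flow_cell /= /flow_radius mulr0 mul0r mulr0 addr0 !polar0.
Qed.

Let flow_cell1 t x s : flow_cell t (x, (s, 1)) = inZ (left (x, s)).
Proof.
have /andP[_ h1] := height_itv x.
rewrite /flow_cell /= drift0 // mulr0 slide0 glue /flow_radius max_l; last lra.
by rewrite divr1 !mulr1 subrK.
Qed.

Let flow_compat t p :
  inZ (left p) = flow_cell t ((right p).1, polar_coord v s0 (right p).2).
Proof.
case: p => x s; rewrite /right /= -(polar1 v).
rewrite (polar_coord_punctured _ (@flow_cell0 t x)) clamp_ge1 // ?flow_cell1 //.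
by right; exact: ltr01.
Qed.

Lemma flow_inl t z : flow t (inZ z) = inZ z.
Proof. by rewrite /flow pushout_rec_inl; last exact: flow_compat. Qed.

Lemma flow_inr t x s r : x <> y \/ 0 < clamp r ->
  flow t (inSD (x, polar v (s, r))) = flow_cell t (x, (s, clamp r)).
Proof.
move=> xr; rewrite /flow pushout_rec_inr; last exact: flow_compat.
exact: (polar_coord_punctured s (@flow_cell0 t x) xr).
Qed.

Lemma max_radius_gt0 x r : 0 <= r -> x <> y \/ 0 < r -> 0 < Num.max r (height x / 2).
Proof.
by move=> r0 [/height_gt0 h|h]; rewrite lt_max; apply/orP; [right; lra|left].
Qed.

Lemma punctured_ind (P : G -> Prop) : (forall z, P (inZ z)) ->
  (forall x s r, 0 <= r <= 1 -> x <> y \/ 0 < r -> P (inSD (x, polar v (s, r)))) ->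
  forall w, G' w -> P w.
Proof.
move=> PZ PS; apply: pushout_ind => [z _|[x d] Gd]; first exact: PZ.
move: Gd; have [[s r] r01 <-] := polar_surj v s0 d => /polar_punctured.
by rewrite clamp_id //; exact: PS.
Qed.

(** A positive radius stays positive, and at radius [0] the sphere coordinate differs
from [y] and keeps doing so. *)
Lemma flow_punctured t w : 0 <= t <= 1 -> G' w -> G' (flow t w).
Proof.
move=> /andP[t0 t1].
apply: (@punctured_ind (fun w => G' (flow t w))) => [z|x s r r01 xr].
  by rewrite flow_inl; exact: inZ_punctured.
rewrite flow_inr clamp_id //; apply/inSD_punctured => -[Ex Er].
move: r01 (r01) => /andP[r0 r1] r01; have mx := max_radius_gt0 r0 xr.
have q01 : 0 <= r / Num.max r (height x / 2) <= 1.
  rewrite divr_ge0 ?(ltW mx) //= ler_pdivrMr // mul1r le_max lexx //.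
have fr01 : 0 <= flow_radius x r t <= 1.
  move: q01; rewrite /flow_radius; set q := r / _ => /andP[q0 q1].
  have tq : t * q <= t by rewrite ler_piMr.
  have tr : (1 - t) * r <= 1 - t by rewrite ler_piMr // subr_ge0.
  have tq0 : 0 <= t * q by rewrite mulr_ge0.
  have tr0 : 0 <= (1 - t) * r by rewrite mulr_ge0 // subr_ge0.
  by apply/andP; split; lra.
case: (pselect (x = y)) => [xy|xy]; last first.
  apply: (slide_neq xy _ Ex); have /andP[d0 d1] := clamp_itv
    (3 * (height x - r) / (height x + r)).
  by rewrite mulr_ge0 //= mulr_ile1.
have r_gt0 : 0 < r by case: xr.
have := polar_eq_centre v_int fr01 Er; apply/eqP; rewrite gt_eqF //.
rewrite /flow_radius; case: (eqVneq t 1) => [->|t_neq1].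
  by rewrite subrr mul0r add0r mul1r divr_gt0.
have tq0 : 0 <= t * (r / Num.max r (height x / 2)).
  by case/andP: q01 => q0 _; rewrite mulr_ge0.
have tr0 : 0 < (1 - t) * r by rewrite mulr_gt0 // subr_gt0 lt_neqAle t_neq1.
by lra.
Qed.

Lemma flow_continuous w t : G' w ->
  {for (w, t), continuous (fun p : G * R => flow (clamp p.2) p.1)}.
Proof.
apply: (@identification_homotopy R _ _ _ _ G'
  (fun p : G * R => flow (clamp p.2) p.1) cover_id punctured_open).
move=> [z|[x [s r]]] {}t Gz.
  apply: at_inl; apply: (@at_eq _ _ (fun p : (N0 * B) * R => inZ p.1)) => [p|].
    by rewrite /= flow_inl.
  by have cZ := @pushout_inl_continuous _ _ _ left right; cts.
apply: at_inr.
have xr := polar_punctured Gz; have /andP[r0 r1] := clamp_itv r.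
have near_G : \forall p \near ((x, (s, r), t) : (S * (B * R)) * R), G' (inSD (box p.1)).
  have cS : continuous (fun p : (S * (B * R)) * R => inSD (box p.1)).
    move=> p; have cb := identification_continuous box_identification.
    by have ci := @pushout_inr_continuous _ _ _ left right; cts.
  by apply: cS; apply: open_nbhs_nbhs; split; [exact: punctured_open|exact: Gz].
pose F (p : (S * (B * R)) * R) :=
  flow_cell (clamp p.2) (p.1.1, (p.1.2.1, clamp p.1.2.2)).
apply: (@at_eq_near _ _ F).
  apply: (@filterS _ (nbhs (x, (s, r), t))) near_G => -[[x' [s' r']] t'].
  by move=> /polar_punctured xr'; rewrite /F /= flow_inr.
have ch := height_continuous; have cp := @polar_continuous R n v.
have ci := @pushout_inr_continuous _ _ _ left right.
set q := ((x, (s, r), t) : (S * (B * R)) * R).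
have cr : {for q, continuous (fun p : (S * (B * R)) * R => clamp p.1.2.2)}.
  by apply: at_clamp; cts.
have ct : {for q, continuous (fun p : (S * (B * R)) * R => clamp p.2)}.
  by apply: at_clamp; cts.
have cx : {for q, continuous (fun p : (S * (B * R)) * R => p.1.1)} by cts.
have cd := at_drift cx cr (height_radius_gt0 r0 xr).
have cs : {for q, continuous (fun p : (S * (B * R)) * R =>
    slide p.1.1 (clamp p.2 * drift p.1.1 (clamp p.1.2.2)))}.
  by apply: at_slide => //; [cts|exact: drift_chord_neq0].
have cm : {for q, continuous (fun p : (S * (B * R)) * R =>
    (Num.max (clamp p.1.2.2) (height p.1.1 / 2))^-1)}.
  by apply: at_inv; [rewrite gt_eqF //; exact: max_radius_gt0|cts].
by rewrite /F /flow_cell /flow_radius /=; cts.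
Qed.

Lemma insert_push : line_homotopic R (insert \o (fun w : G' => push (set_val w))) id.
Proof.
have FG (w : G') t : G' (flow (clamp t) (set_val w)).
  by apply: flow_punctured; [exact: clamp_itv|exact: set_mem (valP w)].
pose L (p : G' * R) : G' := 
  exist (fun w => w \in G') (flow (clamp p.2) (set_val p.1)) (mem_set (FG p.1 p.2)).
apply: line_homotopic_sym; exists L; split.
- move=> p; apply: at_set_type.
  apply: (@at_comp _ _ _ (fun p : G' * R => (set_val p.1, p.2))
    (fun p : G * R => flow (clamp p.2) p.1) p); first by cts.
  by apply: flow_continuous; exact: set_mem (valP p.1).
- move=> w; apply: val_inj; change (flow (clamp 0) (set_val w) = set_val w).
  rewrite clamp_le0 //; have : G' (set_val w) by exact: set_mem (valP w).
  move: (set_val w); apply: (@punctured_ind (fun w => flow 0 w = w)) => [z|x s r r01 xr].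
    by rewrite flow_inl.
  rewrite flow_inr clamp_id // /flow_cell /= mul0r slide0 /flow_radius.
  by rewrite subr0 mul1r mul0r addr0.
- move=> w; apply: val_inj.
  change (flow (clamp 1) (set_val w) = insert0 (push (set_val w))).
  rewrite clamp_ge1 //; have : G' (set_val w) by exact: set_mem (valP w).
  move: (set_val w).
  apply: (@punctured_ind (fun w => flow 1 w = insert0 (push w))) => [z|x s r r01 xr].
    by rewrite flow_inl push_inl insert0_inl.
  have /andP[r0 r1] := r01; have hr := height_radius_gt0 r0 xr.
  rewrite flow_inr ?clamp_id // push_inr ?clamp_id //.
  rewrite /flow_cell /push_cell /= mul1r /flow_radius subrr mul0r add0r mul1r.
  case: lerP => rh.
    by rewrite insert0_inl glue divff // gt_eqF //; lra.
  have h0 : 0 < height x by lra.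
  rewrite insert0_inr drift1 // ?(ltW rh) // slide1.
  by rewrite (_ : r / (height x / 2) = 2 * r / height x) // invfM invrK; ring.
Qed.

(** The punctured product retracts to the part over the boundary sphere together
with the disc over the antipode of [y]. *)
Lemma punctured_gyration_attach_cell : line_equivalent R G' A.
Proof.
exists (fun w : G' => push (set_val w)), insert; split.
- move=> w; apply: (@at_comp _ _ _ set_val push w); first exact: initial_continuous.
  by apply: push_continuous; exact: set_mem (valP w).
- exact: insert_continuous.
- exact: insert_push.
- exact: push_insert.
Qed.

End PuncturedGyration.

Lemma usphere_inhabited (R : realType) (m : nat) : (0 < m)%N ->
  exists s : usphere R m, True.
Proof.
case: m => // m _; have h : (delta_mx 0 0 : 'rV[R]_m.+1) \in usphere R m.+1.
  apply/mem_set; rewrite /usphere /= /sqnorm (bigD1 0) //= big1 => [|i i0].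
    by rewrite mxE eqxx expr1n addr0.
  by rewrite mxE eqxx (negbTE i0) expr0n.
by exists (exist (fun x => x \in usphere R m.+1) _ h).
Qed.

Theorem proposition6p9
  (R : realType) (n : nat) (n_gt0 : (0 < n)%N) (n_even : ~~ odd n)
  (* the Poincare duality complex N = N_0 \cup_g D^(2n) *)
  (N : topologicalType) (N_PD : poincare_duality_complex R (2 * n) N)
  (N0 : topologicalType) (C0 : finite_CW R N0) (C0_dim : (cw_dim C0 < 2 * n)%N)
  (g : usphere R (2 * n) -> N0) (g_cont : continuous g)
  (N_cell : homeomorphic N (attach_cell g))
  (tau : usphere R n -> self_equivs R (2 * n)) (tau_cont : continuous tau)
  (* the removed point, in the interior of the top cell, and the base point *)
  (y : usphere R (2 * n)) (v : udisc R n) (v_int : sqnorm (set_val v) < 1)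
  (pt : N0) :
  homotopy_equivalent R (gyration_minus g tau (y, v))
                        (half_smash pt (usphere R n)).
Proof.
have n_gt1 : (1 < n)%N by case: n n_gt0 n_even {N_PD C0_dim g g_cont N_cell tau tau_cont y v v_int} => [|[]].
have [s0 _] := usphere_inhabited R n_gt0.
have ndN0 x : nondegenerate_point R x := cw_nondegenerate C0 x.
have cN0 : connected [set: N0].
  apply: (attach_cell_connected_base g_cont); first by apply: usphere_connected; lia.
  have [_ cN _ _] := N_PD; have [h [k [ch ck hk kh]]] := N_cell.
  have <- : h @` [set: N] = [set: attach_cell g].
    by apply/seteqP; split=> // w _; exists (k w).
  by apply: connected_continuous_connected cN _; exact: continuous_subspaceT.
apply: line_equivalent_homotopy_equivalent.
apply: line_equivalent_trans
  (punctured_gyration_attach_cell g_cont tau_cont y s0 v_int) _.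
apply: line_equivalent_trans (attach_fibre_half_smash v_int s0
  (cw_hausdorff C0) (ndN0 pt)).
apply: (attach_cell_homotopic v_int s0).
pose tr (s : usphere R n) : usphere R (2 * n) := set_val (tau s) (antipode y).
have ctr : continuous tr.
  move=> s; apply: (@at_comp _ _ _ (fun s : usphere R n => (s, antipode y))
    (fun p => (set_val (tau p.1) : usphere R (2 * n) -> usphere R (2 * n)) p.2) s).
    by cts.
  exact: evaluation_continuous.
have [q trq] : exists q, line_homotopic R tr (fun=> q).
  by apply: sphere_map_nullhomotopic => //; lia.
have [H [cH H0 H1]] : line_homotopic R (g \o tr) (fun=> pt).
  apply: (@line_homotopic_trans _ _ _ (fun=> g q)).
    exact: (line_homotopic_comp trq (line_homotopic_refl R g_cont)).
  exact: constant_maps_homotopic.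
exists (fun p => (H p, p.1)); split=> [p|s|s] /=.
- by cts.
- by rewrite H0.
- by rewrite H1.
Qed.
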